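(* Let $M$ be the interior of a compact, connected, orientable 3-manifold with non-empty boundary consisting of tori, $\mathcal T$ an ideal triangulation of $M$, $\xi\in\mathfrak D_\infty(\mathcal T)$, $N=N(\xi)$, and $\{Z_i\}$ a sequence in $\mathfrak D(\mathcal T)$ strongly converging to $\xi$, with associated representations $\rho_i:\pi_1(M)\to PSL_2(\mathbb C)$. For each $\gamma\in\pi_1(M)$, the sequence $\{u(Z_i)\,l_{\mathbb H}(\rho_i(\gamma))\}$ contains a convergent subsequence, and its limit $l_\xi(\gamma)$ satisfies $$0\le l_\xi(\gamma)\le l_N(\gamma).$$
   Context: **Deformation variety and convergence.** $\mathcal T$ has coherently oriented ideal tetrahedra $\sigma_1,\dots,\sigma_n$ and $n$ ideal edges $e_1,\dots,e_n$. Label the edges of a standard oriented 3-simplex by $z,z',z''$ so that opposite edges have equal labels and all three labels occur at each vertex; fix one of the two such labelings (up to orientation-preserving symmetry) and transfer it to every $\sigma_j$ by an orientation-preserving simplicial map, giving labels $z_j,z_j',z_j''$. Let $a^{(k)}_{jl}$ be the number of edges of $\sigma_j$ with label $z_j^{(k)}$ identified to $e_l$. $\mathfrak D(\mathcal T)\subset(\mathbb C\setminus\{0\})^{3n}$ is the set of $Z=(z_1,z_1',z_1'',\dots,z_n'')$ with $z_j(1-z_j'')=1$, $z_j'(1-z_j)=1$, $z_j''(1-z_j')=1$ and $\prod_j z_j^{a_{jl}}(z_j')^{a'_{jl}}(z_j'')^{a''_{jl}}=1$ for all $j,l$. Put $\log|Z|=(\log|z_1|,\dots,\log|z_n''|)$,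 $u(Z)=(1+\sum(\log|z_j^{(k)}|)^2)^{-1/2}$. $\mathfrak D_\infty(\mathcal T)$ is the set of limit points on $S^{3n-1}$ of the image of $Z\mapsto u(Z)\log|Z|$. $\{Z_i\}$ strongly converges to $\xi$ if $u(Z_i)\log|Z_i|\to\xi$ and each coordinate of $Z_i$ converges in $\mathbb C\cup\{\infty\}$. **Representations.** For $Z\in\mathfrak D(\mathcal T)$ there is a representation $\rho_Z:\pi_1(M)\to PSL_2(\mathbb C)$, unique up to conjugacy, and a $\rho_Z$-equivariant continuous map $D_Z$ from $\widetilde M$ (the universal cover, with the ideal vertices of its tetrahedra added) to $\mathbb H^3\cup\partial\mathbb H^3$ sending each ideal tetrahedron to an ideal hyperbolic tetrahedron with edge invariants given by $Z$: if the vertices are ordered so that $[v_0,v_1]$, $[v_0,v_3]$, $[v_0,v_2]$ have labels $z,z',z''$, then $(v_0,v_1;v_2,v_3)=z$, $(v_0,v_3;v_1,v_2)=z'$, $(v_0,v_2;v_3,v_1)=z''$ at the images, where $(v_i,v_j;v_k,v_l)=\frac{v_i-v_k}{v_i-v_l}\cdot\frac{v_j-v_l}{v_j-v_k}$. Put $\rho_i=\rho_{Z_i}$ and $l_{\mathbb H}(\rho_i(\gamma))=\inf\{d(x,\rho_i(\gamma)x):x\in\mathbb H^3\}$, $d$ the hyperbolic metric. **$N(\xi)$ and $\mathfrak T_N$.** $\sigma_j$ has three normal quadrilateral types $q_j,q_j',q_j''$, where $q_j^{(k)}$ is the type disjoint from the two edges labelled $z_j^{(k)}$. Each coordinate triple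 of $\xi$ has the form $(0,x,-x)$, $(-x,0,x)$ or $(x,-x,0)$ with $x\ge0$; $N(\xi)\in\mathbb R_{\ge 0}^{3n}$ is the vector of quadrilateral coordinates with corresponding triple $(x,0,0)$, $(0,x,0)$, $(0,0,x)$ respectively. For each ideal tetrahedron $\sigma$ of $\widetilde M$, let $k$ be the maximum of the quadrilateral coordinates of $N$ in (the image of) $\sigma$. The dual spine $S(\sigma)$ is the metric tree consisting of an interval $[0,k]$ with two copies of $[0,\infty)$ attached at each endpoint; the four rays correspond to the four ideal vertices of $\sigma$, and if $k>0$ two rays are attached at the same endpoint iff their vertices lie on the same side of the quadrilateral with coordinate $k$. For a face of $\sigma$, removing from $S(\sigma)$ the interior of the ray of the opposite vertex leaves a tripod with three infinite rays, one for each ideal vertex of the face. When two tetrahedra share a face, identify their tripods by the isometry matching centres and ends. The quotient of $\bigsqcup_\sigma S(\sigma)$ carries the quotient pseudo-metric (infimum of lengths of chains of arcs in spines); $\mathfrak T_N$, with metric $d_N$, is the metric space obtained by identifying points at distance zero. It is an $\mathbb R$-tree with an isometric action of $\pi_1(M)$ induced by deck transformations, and $l_N(\gamma)=\inf\{d_N(x,\gamma x):x\in\mathfrak T_N\}$.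
   Formalization: The stated cross ratios for z' and z'' contradict z'(1-z)=1 and z(1-z'')=1 (they force z^2-z+1=0), so they are exchanged: [v0,v1],[v0,v2],[v0,v3] carry z,z',z'' with z'=(v0,v2;v3,v1) and z''=(v0,v3;v1,v2). *)

(* Defs.v *)
From HB Require Import structures.
From mathcomp Require Import all_boot all_order all_fingroup all_algebra.
From mathcomp Require Import complex.
From mathcomp Require Import all_classical all_reals all_analysis.

Set Implicit Arguments.
Unset Strict Implicit.
Unset Printing Implicit Defensive.

Import Order.TTheory GRing.Theory Num.Theory.
Import numFieldNormedType.Exports.

Local Open Scope classical_set_scope.
Local Open Scope ring_scope.

(** * Topology: 3-manifolds, fundamental group, universal cover *)

Definition homeomorphic (X Y : topologicalType) (A : set X) (B : set Y) : Prop :=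
  exists (f : A -> B) (g : B -> A),
    [/\ continuous f, continuous g, cancel f g & cancel g f].

Definition half_space (R : realType) : set 'rV[R]_3 := [set y | 0 <= y 0 0].
Arguments half_space : clear implicits.

Definition has_half_space_charts (R : realType) (W : topologicalType) : Prop :=
  forall x : W, exists (U : set W) (V : set 'rV[R]_3),
    [/\ open U, U x, open V & homeomorphic U (V `&` half_space R)].

Definition mfd_interior (R : realType) (W : topologicalType) : set W :=
  [set x | exists (U : set W) (V : set 'rV[R]_3),
     [/\ open U, U x, open V & homeomorphic U V]].
Arguments mfd_interior : clear implicits.

Definition mfd_boundary (R : realType) (W : topologicalType) : set W :=
  ~` mfd_interior R W.
Arguments mfd_boundary : clear implicits.

Definition torus (R : realType) : set ((R * R) * (R * R)) :=
  [set t | t.1.1 ^+ 2 + t.1.2 ^+ 2 = 1 /\ t.2.1 ^+ 2 + t.2.2 ^+ 2 = 1].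
Arguments torus : clear implicits.

(** Orientability is not part of this predicate: it is supplied by the
    orientation-reversing face pairings of [face_pairing] below. *)
Definition compact_3manifold_with_torus_boundary (R : realType)
    (W : topologicalType) : Prop :=
  [/\ hausdorff_space W, @second_countable W & has_half_space_charts R W] /\
  [/\ compact [set: W], connected [set: W], mfd_boundary R W !=set0 &
      forall x, mfd_boundary R W x ->
        homeomorphic (connected_component (mfd_boundary R W) x) (torus R)].

Definition interior_of_compact_3manifold_with_torus_boundary (R : realType)
    (M : topologicalType) : Prop :=
  exists2 W : topologicalType, compact_3manifold_with_torus_boundary R W &
    homeomorphic [set: M] (mfd_interior R W).

(** Paths are functions on [R] of which only the values on [0, 1] matter. *)
Definition is_path (R : realType) (X : topologicalType) (x y : X) (f : R -> X) :
    Prop :=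
  [/\ {within `[0, 1], continuous f}, f 0 = x & f 1 = y].

Definition path_homotopic (R : realType) (X : topologicalType) (x y : X)
    (f g : R -> X) : Prop :=
  [/\ is_path x y f, is_path x y g &
   exists H : R * R -> X,
   [/\ {within [set` `[0, 1]] `*` [set` `[0, 1]], continuous H},
       forall t, 0 <= t <= 1 -> H (0, t) = f t,
       forall t, 0 <= t <= 1 -> H (1, t) = g t &
       forall s, 0 <= s <= 1 -> H (s, 0) = x /\ H (s, 1) = y]].

Definition path_concat (R : realType) (X : Type) (f g : R -> X) : R -> X :=
  fun t => if t <= 2^-1 then f (2 * t) else g (2 * t - 1).

Definition pi1 (R : realType) (X : topologicalType) (x : X) : set (set (R -> X)) :=
  [set c | exists2 f, is_path x x f & c = [set g | path_homotopic x x f g]].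
Arguments pi1 : clear implicits.

Definition pi1_mul (R : realType) (X : topologicalType) (x : X)
    (c d : set (R -> X)) : set (R -> X) :=
  [set h | exists f g, [/\ c f, d g & path_homotopic x x (path_concat f g) h]].

Definition simply_connected (R : realType) (X : topologicalType) : Prop :=
  (forall x y : X, exists f : R -> X, is_path x y f) /\
  (forall (x : X) (f : R -> X), is_path x x f -> path_homotopic x x f (cst x)).
Arguments simply_connected : clear implicits.

Definition evenly_covered (E X : topologicalType) (p : E -> X) (U : set X) : Prop :=
  exists (I : Type) (V : I -> set E),
    [/\ forall i, open (V i),
        trivIset [set: I] V,
        p @^-1` U = \bigcup_i V i &
        forall i, exists q : U -> E,
          [/\ continuous q, forall x, V i (q x), forall x, p (q x) = set_val x &
              forall (e : E) (x : U), V i e -> p e = set_val x -> q x = e]].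

Definition universal_cover (R : realType) (E X : topologicalType) (p : E -> X) :
    Prop :=
  [/\ continuous p,
      forall x, exists U : set X, [/\ open U, U x & evenly_covered p U] &
      simply_connected R E].
Arguments universal_cover : clear implicits.

Definition deck_transformation (E X : topologicalType) (p : E -> X) (tau : E -> E) :
    Prop :=
  continuous tau /\ (forall e, p (tau e) = p e) /\
  exists2 tau' : E -> E, continuous tau' & cancel tau tau' /\ cancel tau' tau.

(** The class [c] acts on the universal cover by the deck transformation taking
    [e0] to the endpoint of the lift at [e0] of a loop in [c]; with
    [path_concat] (first loop first) this is a left action of [pi1]. *)
Definition pi1_deck_action (R : realType) (E X : topologicalType) (p : E -> X)
    (e0 : E) (dk : set (R -> X) -> E -> E) : Prop :=
  forall c, pi1 R X (p e0) c ->
    deck_transformation p (dk c) /\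
    exists f : R -> E, is_path e0 (dk c e0) f /\ c (p \o f).

(** * Ideal triangulations *)

Definition closed_simplex (R : realType) : set 'rV[R]_4 :=
  [set x | (forall v, 0 <= x 0 v) /\ \sum_v x 0 v = 1].
Arguments closed_simplex : clear implicits.

(** The closed simplex with its four vertices removed. *)
Definition ideal_simplex (R : realType) : set 'rV[R]_4 :=
  [set x | closed_simplex R x /\ forall v, x 0 v != 1].
Arguments ideal_simplex : clear implicits.

(** Face [f] of tetrahedron [j], the face opposite to vertex [f], is glued to
    face [fp_perm j f f] of tetrahedron [fp_adj j f] by the affine map
    taking each vertex [v != f] to [fp_perm j f v]. Each tetrahedron is oriented
    by the order 0, 1, 2, 3 of its vertices; the orientations are coherent, i.e.
    the face pairings reverse the induced orientations, iff the permutations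
    are odd. *)
Record face_pairing (n : nat) := FacePairing {
  fp_adj : 'I_n -> 'I_4 -> 'I_n;
  fp_perm : 'I_n -> 'I_4 -> 'S_4;
  fp_adjK : forall j f, fp_adj (fp_adj j f) (fp_perm j f f) = j;
  fp_permK : forall j f,
    fp_perm (fp_adj j f) (fp_perm j f f) = (fp_perm j f)^-1%g;
  fp_free : forall j f, (fp_adj j f, fp_perm j f f) != (j, f);
  fp_odd : forall j f, odd_perm (fp_perm j f) }.

Section Triangulation.
Variables (R : realType) (n : nat) (T : face_pairing n).

Inductive simplex_identified : 'I_n * ideal_simplex R -> 'I_n * ideal_simplex R ->
    Prop :=
| si_refl a : simplex_identified a a
| si_step j f (x y : ideal_simplex R) b :
    set_val x 0 f = 0 ->
    (forall v, set_val y 0 (fp_perm T j f v) = set_val x 0 v) ->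
    simplex_identified (fp_adj T j f, y) b ->
    simplex_identified (j, x) b.

(** [phi j] is the characteristic map of the [j]-th ideal tetrahedron: these maps
    identify [M] with the quotient of the disjoint union of the ideal
    tetrahedra by the face pairings. *)
Definition ideal_triangulation (M : topologicalType)
    (phi : 'I_n -> ideal_simplex R -> M) : Prop :=
  [/\ forall m, exists j x, phi j x = m,
      forall j x k y, phi j x = phi k y <-> simplex_identified (j, x) (k, y) &
      forall U : set M, open U <-> forall j, open (phi j @^-1` U)].

(** The edges with labels z, z', z'' (labels 0, 1, 2) at vertex 0 are those
    joining it to the vertices 1, 2, 3 in this order. A labelling of each
    tetrahedron by an orientation-preserving map from the standard simplex
    amounts to numbering its vertices accordingly; the other labelling
    is obtained by reversing all the orientations, e.g. by exchanging the
    numbers 2 and 3 in every tetrahedron, which leaves all the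
    permutations odd. *)
Definition edge_label (e : {set 'I_4}) : 'I_3 :=
  if (e == [set 0; 1]%SET) || (e == [set 2%:R; 3%:R]%SET) then 0
  else if (e == [set 0; 2%:R]%SET) || (e == [set 1; 3%:R]%SET) then 1
  else 2%:R.

Definition tet_edges : {set 'I_n * {set 'I_4}} := [set je : 'I_n * {set 'I_4} | #|je.2| == 2%N]%SET.

Definition edge_glued : rel ('I_n * {set 'I_4}) := fun a b =>
  [exists f, (f \notin a.2) &&
     (b == (fp_adj T a.1 f, [set fp_perm T a.1 f v | v in a.2]%SET))].

(** The ideal edges of the triangulation, each being the class of the
    edges of tetrahedra that are identified to it. *)
Definition ideal_edges : {set {set 'I_n * {set 'I_4}}} :=
  [set [set b | connect edge_glued a b] | a in tet_edges]%SET.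

Definition edge_incidence (l : {set 'I_n * {set 'I_4}}) (j : 'I_n) (k : 'I_3) : nat :=
  #|[set e : {set 'I_4} | ((j, e) \in l) && (edge_label e == k)]%SET|.

(** * Deformation variety *)

Definition deformation_variety : set 'M[R[i]]_(n, 3) :=
  [set Z | [/\ forall j k, Z j k != 0,
    forall j, [/\ Z j 0 * (1 - Z j 2%:R) = 1,
                  Z j 1 * (1 - Z j 0) = 1 &
                  Z j 2%:R * (1 - Z j 1) = 1] &
    forall l, l \in ideal_edges ->
      \prod_j \prod_k Z j k ^+ edge_incidence l j k = 1]].

Definition log_abs (Z : 'M[R[i]]_(n, 3)) : 'M[R]_(n, 3) :=
  \matrix_(j, k) ln (complex.Re `|Z j k|).

Definition scale_u (Z : 'M[R[i]]_(n, 3)) : R :=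
  (Num.sqrt (1 + \sum_j \sum_k log_abs Z j k ^+ 2))^-1.

Definition D_infinity : set 'M[R]_(n, 3) :=
  [set xi : 'M[R]_(n, 3) | \sum_j \sum_k xi j k ^+ 2 = 1 /\
     limit_point [set scale_u Z *: log_abs Z | Z in deformation_variety] xi].

Definition strongly_converges (Z : nat -> 'M[R[i]]_(n, 3)) (xi : 'M[R]_(n, 3)) :
    Prop :=
  (scale_u (Z i) *: log_abs (Z i) @[i --> \oo] --> xi) /\
  forall j k,
    (exists c : R[i], complex.Re `|Z i j k - c| @[i --> \oo] --> 0) \/
    (complex.Re `|Z i j k| @[i --> \oo] --> +oo).

(** Coordinate [k] of each triple is the quadrilateral type separating the two
    edges with label [k]. The triples (0,x,-x), (-x,0,x), (x,-x,0) are sent to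
    (x,0,0), (0,x,0), (0,0,x). *)
Definition quad_coords (xi : 'M[R]_(n, 3)) : 'M[R]_(n, 3) :=
  \matrix_(j, k) if (xi j k == 0) && (0 <= xi j (k + 1)) then xi j (k + 1) else 0.

End Triangulation.

(** * Hyperbolic space, in the Klein model

    A point [x] of the closed unit ball is also viewed as the ray of the
    positive semi-definite hermitian matrix [herm x], on which [A] in SL_2(C) acts
    by X |-> A X A^*. The class of (z, 1) in the projective line
    corresponds to the ideal point given by stereographic projection of z. *)

Section Hyperbolic.
Variable R : realType.

Definition dot (x y : 'rV[R]_3) : R := \sum_k x 0 k * y 0 k.

Definition H3 : set 'rV[R]_3 := [set x | dot x x < 1].
Definition H3_infinity : set 'rV[R]_3 := [set x | dot x x = 1].

Definition arcosh (t : R) : R := ln (t + Num.sqrt (t ^+ 2 - 1)).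

Definition hdist (x y : 'rV[R]_3) : R :=
  arcosh ((1 - dot x y) / Num.sqrt ((1 - dot x x) * (1 - dot y y))).

Definition herm (x : 'rV[R]_3) : 'M[R[i]]_2 :=
  \matrix_(a, b)
    if a == 0 then (if b == 0 then Complex (1 + x 0 2%:R) 0
                    else Complex (x 0 0) (x 0 1))
    else (if b == 0 then Complex (x 0 0) (- x 0 1)
          else Complex (1 - x 0 2%:R) 0).

Definition unherm (X : 'M[R[i]]_2) : 'rV[R]_3 :=
  \row_k ((if k == 0 then 2 * complex.Re (X 0 1)
           else if k == 1 then 2 * complex.Im (X 0 1)
           else complex.Re (X 0 0 - X 1 1)) / complex.Re (X 0 0 + X 1 1)).

Definition adjoint (m q : nat) (A : 'M[R[i]]_(m, q)) : 'M[R[i]]_(q, m) :=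
  (map_mx (@conjc R) A)^T.

Definition psl_act (A : 'M[R[i]]_2) (x : 'rV[R]_3) : 'rV[R]_3 :=
  unherm (A *m herm x *m adjoint A).

Definition ideal_point (w : 'cV[R[i]]_2) : 'rV[R]_3 := unherm (w *m adjoint w).

Definition translation_length (A : 'M[R[i]]_2) : R :=
  inf [set hdist x (psl_act A x) | x in H3].

(** The cross ratio (vi - vk)/(vi - vl) * (vj - vl)/(vj - vk), in homogeneous
    coordinates so that the point at infinity is allowed. *)
Definition cross_ratio (wi wj wk wl : 'cV[R[i]]_2) : R[i] :=
  let dt (a b : 'cV[R[i]]_2) := \det (row_mx a b : 'M[R[i]]_2) in
  (dt wi wk / dt wi wl) * (dt wj wl / dt wj wk).

Definition convex_hull (P : 'I_4 -> 'rV[R]_3) : set 'rV[R]_3 :=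
  [set y | exists c : 'I_4 -> R,
     [/\ forall v, 0 <= c v, \sum_v c v = 1 & y = \sum_v c v *: P v]].

(** With z' = 1/(1-z) and z'' = 1-1/z, the cross ratios below are
    compatible with each other for the labels of [edge_label]: if
    (v0,v1,v2) = (infinity, 0, 1) then they force v3 = z. *)
Definition edge_invariants (P : 'I_4 -> 'rV[R]_3) (z : 'I_3 -> R[i]) : Prop :=
  exists w : 'I_4 -> 'cV[R[i]]_2,
    [/\ forall v, w v != 0 /\ ideal_point (w v) = P v,
        cross_ratio (w 0) (w 1) (w 2%:R) (w 3%:R) = z 0,
        cross_ratio (w 0) (w 2%:R) (w 3%:R) (w 1) = z 1 &
        cross_ratio (w 0) (w 3%:R) (w 1) (w 2%:R) = z 2%:R].

End Hyperbolic.

(** * Tetrahedra of the universal cover, representations and the dual tree *)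

Section UniversalCover.
Variables (R : realType) (n : nat) (T : face_pairing n).
Variables (M : topologicalType) (phi : 'I_n -> ideal_simplex R -> M).
Variables (E : topologicalType) (p : E -> M).

(** The ideal tetrahedra of the universal cover over the [j]-th one are the lifts
    of its characteristic map. *)
Definition tet := ('I_n * (ideal_simplex R -> E))%type.

Definition is_tet (s : tet) : Prop :=
  continuous s.2 /\ forall x, p (s.2 x) = phi s.1 x.

Definition share_face (s t : tet) (f : 'I_4) : Prop :=
  [/\ is_tet s, is_tet t, t.1 = fp_adj T s.1 f &
      forall x y : ideal_simplex R, set_val x 0 f = 0 ->
        (forall v, set_val y 0 (fp_perm T s.1 f v) = set_val x 0 v) ->
        t.2 y = s.2 x].

Definition tet_act (tau : E -> E) (s : tet) : tet := (s.1, tau \o s.2).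

Variables (e0 : E) (dk : set (R -> M) -> E -> E).

(** Representations into PSL_2(C), given by representatives in SL_2(C) that are
    well defined up to sign. *)
Definition psl2_representation (rho : set (R -> M) -> 'M[R[i]]_2) : Prop :=
  (forall c, pi1 R M (p e0) c -> \det (rho c) = 1) /\
  (forall c d, pi1 R M (p e0) c -> pi1 R M (p e0) d ->
     let cd := pi1_mul (p e0) c d in
     rho cd = rho c *m rho d \/ rho cd = - (rho c *m rho d)).

(** [D] is the developing map on the universal cover and [Dv] on the added
    ideal vertices, [Dv s v] being the image of vertex [v] of the tetrahedron [s].
    Continuity is with respect to the topology coherent with the closed
    tetrahedra. *)
Definition developing_map (Z : 'M[R[i]]_(n, 3)) (rho : set (R -> M) -> 'M[R[i]]_2)
    (D : E -> 'rV[R]_3) (Dv : tet -> 'I_4 -> 'rV[R]_3) : Prop :=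
  [/\ (forall e, H3 (D e)) /\
      (forall s v, is_tet s -> H3_infinity (Dv s v)),
      (forall s t f v, share_face s t f -> v != f ->
         Dv t (fp_perm T s.1 f v) = Dv s v),
      (forall c, pi1 R M (p e0) c ->
         (forall e, D (dk c e) = psl_act (rho c) (D e)) /\
         (forall s v, is_tet s ->
            Dv (tet_act (dk c) s) v = psl_act (rho c) (Dv s v))),
      (forall s, is_tet s -> exists F : closed_simplex R -> 'rV[R]_3,
         [/\ continuous F,
             (forall x y, set_val x = set_val y -> F x = D (s.2 y)),
             (forall x v, set_val x = delta_mx 0 v -> F x = Dv s v) &
             range F = convex_hull (Dv s)]) &
      (forall s, is_tet s -> edge_invariants (Dv s) (Z s.1))].

Definition associated_representation (Z : 'M[R[i]]_(n, 3))
    (rho : set (R -> M) -> 'M[R[i]]_2) : Prop :=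
  psl2_representation rho /\ exists D Dv, developing_map Z rho D Dv.

Variable N : 'M[R]_(n, 3).

Definition quad_max (j : 'I_n) : R := Num.max (N j 0) (Num.max (N j 1) (N j 2%:R)).

(** The vertices [v] and [w] are on the same side of the quadrilateral type
    attaining the maximum: a quadrilateral separates two opposite edges, whose
    common label is its index. *)
Definition same_side (j : 'I_n) (v w : 'I_4) : bool :=
  (v == w) || (N j (edge_label [set v; w]%SET) == quad_max j).

(** Points of the dual spine of a tetrahedron: [Seg x] is the point [x] of the
    interval [0, k], [Ray v r] the point [r] of the ray of vertex [v], which is
    attached at the point [ray_pos j v] of the interval. The attaching
    points [Ray v 0] and [Seg (ray_pos j v)] are at distance zero. *)
Inductive spine_pt := Seg of R | Ray of 'I_4 & R.

Definition ray_pos (j : 'I_n) (v : 'I_4) : R :=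
  if same_side j 0 v then 0 else quad_max j.

Definition in_spine (j : 'I_n) (q : spine_pt) : Prop :=
  match q with
  | Seg x => 0 <= x <= quad_max j
  | Ray _ r => 0 <= r
  end.

Definition spine_len (j : 'I_n) (q q' : spine_pt) : R :=
  match q, q' with
  | Seg x, Seg y => `|x - y|
  | Seg x, Ray v r => `|x - ray_pos j v| + r
  | Ray v r, Seg x => `|x - ray_pos j v| + r
  | Ray v r, Ray w s =>
      if v == w then `|r - s| else r + `|ray_pos j v - ray_pos j w| + s
  end.

(** The spine minus the ray of [f] branches at the endpoint of the interval
    where the ray of [f] is not attached. *)
Definition tripod_centre (j : 'I_n) (f : 'I_4) : R :=
  if ray_pos j f == 0 then quad_max j else 0.

(** The point at distance [r] from the centre of the tripod of face [f],
    in the direction of the vertex [w] of that face. *)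
Definition tripod_pt (j : 'I_n) (f w : 'I_4) (r : R) : spine_pt :=
  let c := tripod_centre j f in
  let l := `|c - ray_pos j w| in
  if r <= l then Seg `|c - r| else Ray w (r - l).

(** Points of the disjoint union of the spines. *)
Definition spines_pt := (tet * spine_pt)%type.

Definition is_spines_pt (a : spines_pt) : Prop :=
  is_tet a.1 /\ in_spine a.1.1 a.2.

Definition tripod_glued (a b : spines_pt) : Prop :=
  exists f w r, [/\ share_face a.1 b.1 f, w != f, 0 <= r,
    a.2 = tripod_pt a.1.1 f w r &
    b.2 = tripod_pt b.1.1 (fp_perm T a.1.1 f f) (fp_perm T a.1.1 f w) r].

(** [spine_chain a b L]: a chain of arcs in spines of total length [L] joins
    [a] to [b] in the quotient. *)
Inductive spine_chain : spines_pt -> spines_pt -> R -> Prop :=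
| chain_nil a : is_spines_pt a -> spine_chain a a 0
| chain_arc s q q' b L : is_spines_pt (s, q) -> is_spines_pt (s, q') ->
    spine_chain (s, q') b L -> spine_chain (s, q) b (spine_len s.1 q q' + L)
| chain_glue a a' b L : tripod_glued a a' ->
    spine_chain a' b L -> spine_chain a b L.

Local Open Scope ereal_scope.

Definition spine_dist (a b : spines_pt) : \bar R :=
  ereal_inf [set L%:E | L in spine_chain a b].

(** The points of the tree are the classes of points at distance zero. *)
Definition dual_tree : set (set spines_pt) :=
  [set A | exists2 a, is_spines_pt a &
     A = [set b | is_spines_pt b /\ spine_dist a b = 0]].

Definition tree_dist (A B : set spines_pt) : \bar R :=
  ereal_inf [set spine_dist ab.1 ab.2 | ab in A `*` B].

Definition tree_act (tau : E -> E) (A : set spines_pt) : set spines_pt :=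
  [set (tet_act tau a.1, a.2) | a in A].

Definition tree_translation_length (tau : E -> E) : \bar R :=
  ereal_inf [set tree_dist A (tree_act tau A) | A in dual_tree].

End UniversalCover.

(* Main.v *)
Require Import Defs.
From mathcomp Require Import all_boot all_order all_fingroup all_algebra.
From mathcomp Require Import complex ring lra.
From mathcomp Require Import all_classical all_reals all_analysis.
Import Order.TTheory GRing.Theory Num.Theory.
Import numFieldNormedType.Exports.
Local Open Scope classical_set_scope.
Local Open Scope ring_scope.

(** Rescaled by [scale_u (Z i)], the developed ideal tetrahedra degenerate to the
    dual spines: the distance between two points of hyperbolic space that sit at
    given places of a spine is, after rescaling, at most the distance of these
    places in the spine, up to an error that tends to 0 with [i]. A chain of arcs
    joining a point of the spines to its translate by [gamma] is followed in
    hyperbolic space by a sequence of points from some [x] to [rho_i gamma x], so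
    that the rescaled translation length is at most the length of the chain plus an
    error. Letting [i] tend to infinity and then minimising over the chains gives
    the inequality.

    Points of hyperbolic space are handled through frames: a pair [g] of independent
    vectors of C^2 stands for the ray of the hermitian matrix g1 g1^* + g2 g2^*. The
    quantity [frame_len g h], the logarithm of
    (sum of the |det(g_i, h_j)|^2) / (|det g| |det h|), is log (2 cosh d) for the
    hyperbolic distance d of the two points. It bounds d from above
    ([hdist_frame_len]), satisfies the triangle inequality without additive constant
    ([frame_len_triangle]), and involves nothing but 2 x 2 determinants. Three
    ideal points a, b, c and a real r give the frame [tripod_frame a b c r] of the
    point of the geodesic ab at signed distance r, towards a, from the foot of the
    perpendicular from c. It depends on the ideal points alone, so that two
    tetrahedra sharing a face, or a tetrahedron and its translates, have
    corresponding frames.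

    For two such frames in one tetrahedron, [frame_len] is, up to a constant, the
    maximum of four sums of logarithms of determinants of vectors representing the
    ideal vertices. The cross ratios control these logarithms after
    rescaling: up to constants attached to the vertices, their doubles converge to the
    distances between the points of the spine where the rays are attached
    ([four_point_normalisation], [tropical_shape]). The four terms become
    delta(v, w) - b_v(q) - b_w(q'), where b_v is the Busemann function of the end v
    of the spine, and each of them is at most the distance of q and q' because
    Busemann functions are 1-Lipschitz ([frame_len_presents]). Summing along a
    chain gives [chain_bound], and closing up the chain gives
    [translation_length_chain]. The special shape of the triples of [xi] comes
    from the triangle inequality for z, 1 - z and 1 ([limit_tropical]).

    A convergent subsequence exists as soon as the rescaled translation lengths are
    bounded, that is, as soon as some point of the spines is joined to its translate
    by a chain. This is a connectedness statement about the universal cover: the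
    characteristic maps of the tetrahedra lift, since ideal simplices are
    contractible ([lift_contractible]); every lift has a neighbour across each
    face; and the universal cover has the topology coherent with the lifts
    ([open_from_tets]), so that the union of the lifts that are reached from a given
    one through faces is open and closed, hence everything ([tets_connected]). *)

Set Implicit Arguments.
Unset Strict Implicit.
Unset Printing Implicit Defensive.

Local Notation "x %:C" := (real_complex _ x) : ring_scope.

(** * Lifting to covering spaces *)

Section Covering.
Variable (R : realType).

Lemma connected_constant (X : topologicalType) (P : X -> Prop) (x0 x : X) :
  connected [set: X] -> (forall y, \forall z \near y, P z <-> P y) -> P x0 -> P x.
Proof.
move=> cX locP P0.
have oP : open [set y | P y].
  by rewrite openE => y /= Py; apply: filterS (locP y) => z [_]; exact.
have oNP : open [set y | ~ P y].
  by rewrite openE => y /= Py; apply: filterS (locP y) => z [+ _] => zy /zy.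
suff PT : [set y | P y] = [set: X] by have : [set: X] x by []; rewrite -PT.
apply: cX; first by exists x0.
- by exists [set y | P y]; rewrite // setTI.
- exists [set y | P y]; last by rewrite setTI.
  by rewrite -openC; exact: oNP.
Qed.

Lemma connected_line : connected [set: R].
Proof. by apply/connected_intervalP => x y _ _ z _. Qed.

Variables (E M : topologicalType) (p : E -> M) (e0 : E).
Hypothesis cov : forall x, exists U : set M, [/\ open U, U x & evenly_covered p U].

(** The data of an evenly covered neighbourhood, with each local section extended
    arbitrarily to a function on the whole base, which spares subtypes in what
    follows. *)
Lemma sheets m : exists (U : set M) (I : Type) (V : I -> set E) (Q : I -> M -> E),
  [/\ open U, U m, forall i, open (V i), trivIset setT V & p @^-1` U = \bigcup_i V i] /\
  forall i, [/\ forall y, U y -> V i (Q i y) /\ p (Q i y) = y,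
    forall y, U y -> {for y, continuous (Q i)} &
    forall e, V i e -> Q i (p e) = e].
Proof.
have [U [oU Um [I [V [oV tV UV secV]]]]] := cov m.
have [q qP] := choice secV.
exists U, I, V, (fun i => valL_ e0 (q i)); split => // i.
have [cq Vq pq qp] := qP i.
have qE y (Uy : U y) : valL_ e0 (q i) y = q i (SigSub (mem_set Uy)).
  by rewrite -[q i in RHS](@valLK _ _ e0 U).
split.
- by move=> y Uy; rewrite qE; split; [exact: Vq|rewrite pq].
- have /subspace_valL_continuousP' := cq; move=> /(_ e0).
  by rewrite continuous_open_subspace // => h y Uy; apply: h; rewrite inE.
- move=> e Ve; have Upe : U (p e).
    by have : (p @^-1` U) e; [rewrite UV; exists i|].
  by rewrite qE; apply: qp.
Qed.

(** Two sheets over an evenly covered set are equal or disjoint, so agreement and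
    disagreement of two lifts are both open conditions. *)
Lemma lift_unique (X : topologicalType) (f g : X -> E) (x0 : X) :
  connected [set: X] -> continuous f -> continuous g -> (forall x, p (f x) = p (g x)) ->
  f x0 = g x0 -> f =1 g.
Proof.
move=> cX cf cg pfg fg0 x; apply: (@connected_constant _ (fun x => f x = g x) x0) => // {x} y.
have [U [I [V [Q [[oU Um oV tV UV] QP]]]]] := sheets (p (f y)).
have [i _ Vi] : (\bigcup_i V i) (f y) by rewrite -UV.
have [k _ Vk] : (\bigcup_i V i) (g y) by rewrite -UV /= -pfg.
have nf : \forall z \near y, V i (f z).
  by apply: cf; apply: open_nbhs_nbhs; split => //; exact: oV.
have ng : \forall z \near y, V k (g z).
  by apply: cg; apply: open_nbhs_nbhs; split => //; exact: oV.
near=> z.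
have Vfz : V i (f z) by near: z.
have Vgz : V k (g z) by near: z.
split => fg.
- have ik : i = k by apply: tV => //; exists (f z); split => //; rewrite fg.
  subst k; have [_ _ Qp] := QP i.
  by rewrite -(Qp _ Vi) -(Qp _ Vk) pfg.
- have ik : i = k by apply: tV => //; exists (f y); split => //; rewrite fg.
  subst k; have [_ _ Qp] := QP i.
  by rewrite -(Qp _ Vfz) -(Qp _ Vgz) pfg.
Unshelve. all: by end_near. Qed.

Lemma continuous_paste (X : topologicalType) (f g : R -> X) (a : R) :
  continuous f -> continuous g -> f a = g a ->
  continuous (fun t => if t <= a then f t else g t).
Proof.
move=> cf cg fga; apply/continuous_subspace_setT.
have -> : [set: R] = [set t | t <= a] `|` [set t | a <= t].
  by rewrite predeqE => t; split => // _; have /orP := le_total t a.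
apply: withinU_continuous; [exact: closed_le|exact: closed_ge| |].
- apply: (@subspace_eq_continuous _ _ _ f); last exact: continuous_subspaceT.
  by move=> t; rewrite inE /= => ta; rewrite /from_subspace ta.
- apply: (@subspace_eq_continuous _ _ _ g); last exact: continuous_subspaceT.
  move=> t; rewrite inE /= /from_subspace => ta; case: ifP => // ta'.
  by have -> : t = a; [apply/eqP; rewrite eq_le ta ta'|].
Qed.

Lemma continuous_minr (a : R) : continuous (fun t : R => Num.min a t).
Proof.
move=> x.
exact: (@continuous_min R R (cst a) id x (@cst_continuous _ _ _ x) (@cvg_id _ _)).
Qed.

Lemma continuous_maxr (a : R) : continuous (fun t : R => Num.max a t).
Proof.
move=> x.
exact: (@continuous_max R R (cst a) id x (@cst_continuous _ _ _ x) (@cvg_id _ _)).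
Qed.

(** The lift is built on the stopped paths [phi (Num.min T t)]: the set of the [T] for
    which one exists is open and closed in the line. Stopping the path makes every
    partial lift a function on the whole line, so that no lift is ever restricted to an
    interval. *)
Lemma lift_path (phi : R -> M) (e : E) :
  continuous phi -> (forall t, t <= 0 -> phi t = phi 0) -> p e = phi 0 ->
  forall T, exists f : R -> E,
    [/\ continuous f, f 0 = e & forall t, p (f t) = phi (Num.min T t)].
Proof.
move=> cphi phi0 pe T.
pose P T := exists f : R -> E,
    [/\ continuous f, f 0 = e & forall t, p (f t) = phi (Num.min T t)].
have P_le a b : a <= b -> P b -> P a.
  move=> ab [f [cf f0 pf]].
  have [a0|a0] := leP a 0.
    exists (cst e); split => // [|t]; first exact: cst_continuous.
    by rewrite /= phi0 ?ge_min ?a0.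
  exists (f \o Num.min a); split.
  - by move=> t; apply: continuous_comp; [exact: continuous_minr|exact: cf].
  - by rewrite /= min_r // ltW.
  - by move=> t; rewrite /= pf minA (min_r ab).
have P_ext a c m U I (V : I -> set E) (Q : I -> M -> E) : a <= c ->
    [/\ open U, U m, forall i, open (V i), trivIset setT V & p @^-1` U = \bigcup_i V i] /\
    (forall i, [/\ forall y, U y -> V i (Q i y) /\ p (Q i y) = y,
    forall y, U y -> {for y, continuous (Q i)} &
    forall e, V i e -> Q i (p e) = e]) ->
    (forall t, a <= t <= c -> U (phi t)) -> P a -> P c.
  move=> ac [[oU Um oV tV UV] QP] Uphi Pa.
  have P0 : P 0.
    exists (cst e); split => // [|t]; first exact: cst_continuous.
    by rewrite /= phi0 ?ge_min ?lexx.
  have [c0|c0] := leP c 0; first exact: (P_le c 0).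
  pose a' := Num.max a 0.
  have a'0 : 0 <= a' by rewrite le_max lexx orbT.
  have aa' : a <= a' by rewrite le_max lexx.
  have a'c : a' <= c by rewrite ge_max ac ltW.
  have [f [cf f0 pf]] : P a' by rewrite /a' /Num.max; case: ifP.
  have pfa : p (f a') = phi a' by rewrite pf minxx.
  have [i _ Vi] : (\bigcup_i V i) (f a').
    by rewrite -UV /= pfa; apply: Uphi; rewrite aa' a'c.
  have [VQ cQ Qp] := QP i.
  (* past [a'], continue in the sheet of [f a'] *)
  exists (fun t => if t <= a' then f t else Q i (phi (Num.min c (Num.max a' t)))).
  have Uc t : U (phi (Num.min c (Num.max a' t))).
    by apply: Uphi; rewrite le_min ac le_max aa' ge_min lexx.
  split.
  - apply: continuous_paste => //; last by rewrite maxxx min_r // -pfa Qp.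
    move=> t; apply: continuous_comp; last by apply: cQ; exact: Uc.
    apply: continuous_comp; last exact: cphi.
    by apply: continuous_comp; [exact: continuous_maxr|exact: continuous_minr].
  - by rewrite a'0.
  - move=> t; case: ifP => [|/negbT]; rewrite -?ltNge => ta.
      by rewrite pf !min_r // (le_trans ta).
    by have [_ ->] := VQ _ (Uc t); rewrite (max_r (ltW ta)).
apply: (@connected_constant _ P 0 T); first exact: connected_line.
- move=> b; have [U [I [V [Q UQ]]]] := sheets (phi b).
  have [[oU Ub _ _ _] _] := UQ.
  have : nbhs b (phi @^-1` U) by apply: cphi; apply: open_nbhs_nbhs.
  move=> /nbhs_ballP[d /= d0 dU].
  near=> z.
  have zd : ball b d z by near: z; exact: nbhsx_ballx.
  have [zb|bz] := leP z b.
  - split; last exact: P_le.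
    apply: (P_ext z b _ _ _ _ _ zb UQ) => t /andP[zt tb]; apply: dU.
    move: zd; rewrite /ball /= !ger0_norm ?subr_ge0 //; apply: le_lt_trans.
    by rewrite lerD2l lerN2.
  - split; first by apply: P_le; exact: ltW.
    apply: (P_ext b z _ _ _ _ _ (ltW bz) UQ) => t /andP[zt tb]; apply: dU.
    move: zd; rewrite /ball /= distrC (distrC b t) !ger0_norm ?subr_ge0 // ?(ltW bz) //.
    by apply: le_lt_trans; rewrite lerD2r.
- exists (cst e); split => // [|t]; first exact: cst_continuous.
  by rewrite /= phi0 ?ge_min ?lexx.
Unshelve. all: by end_near. Qed.

Lemma between_ball (b d t1 t2 s : R) : ball b d t1 -> ball b d t2 ->
  Num.min t1 t2 <= s -> s <= Num.max t1 t2 -> ball b d s.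
Proof.
rewrite /ball /= !ltr_distl => /andP[? ?] /andP[? ?].
by case: (leP t1 t2) => ? ? ?; apply/andP; split; lra.
Qed.

(** The lift of [phi] at [y] is the end of the lift [L y] of the path that the
    contraction draws from [x0] to [y]. For its continuity at [x], the set of the times
    [t] at which [L y t] is continuous in [y] at [x] is open and closed in the line:
    near a given time, all the paths [L y] with [y] close to [x] stay in one sheet. *)
Lemma lift_contractible (X : topologicalType) (c : X * R -> X) (phi : X -> M)
    (x0 : X) (e : E) :
  continuous c -> continuous phi -> (forall y t, t <= 0 -> c (y, t) = x0) ->
  (forall y, c (y, 1) = y) -> (forall t, c (x0, t) = x0) -> p e = phi x0 ->
  exists s : X -> E, [/\ continuous s, forall y, p (s y) = phi y & s x0 = e].
Proof.
move=> cc cphi c0 c1 cx0 pe.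
have ccl y : continuous (fun t => phi (c (y, t))).
  move=> t; apply: continuous_comp; last exact: cphi.
  apply: (continuous_comp (f := fun t => (y, t))); last exact: cc.
  by exact: (cvg_pair (@cst_continuous _ _ _ _) (@cvg_id _ _)).
have ccr t : continuous (fun y => phi (c (y, t))).
  move=> y; apply: continuous_comp; last exact: cphi.
  apply: (continuous_comp (f := fun y => (y, t))); last exact: cc.
  by exact: (cvg_pair (@cvg_id _ _) (@cst_continuous _ _ _ _)).
have cc2 : continuous (fun yt : X * R => phi (c (yt.1, Num.min 1 yt.2))).
  move=> yt; apply: continuous_comp; last exact: cphi.
  apply: (continuous_comp (f := fun yt : X * R => (yt.1, Num.min 1 yt.2))); last exact: cc.
  have cf : {for yt, continuous (@fst X R)} by exact: cvg_fst.
  have cs : {for yt, continuous (@snd X R)} by exact: cvg_snd.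
  have cs' : {for yt, continuous (fun yt : X * R => Num.min 1 yt.2)}.
    by apply: (continuous_comp cs); exact: continuous_minr.
  exact: (cvg_pair cf cs').
have Lex y := @lift_path (fun t => phi (c (y, t))) e (ccl y).
have {Lex} /choice[L LP] : forall y, exists f : R -> E, [/\ continuous f, f 0 = e &
    forall t, p (f t) = phi (c (y, Num.min 1 t))].
  move=> y; have [|| f fP] := Lex y _ _ 1; [|by rewrite c0|by exists f].
  by move=> t t0; rewrite !c0.
have pL y t : p (L y t) = phi (c (y, Num.min 1 t)) by have [_ _] := LP y.
have cL y : continuous (L y) by have [] := LP y.
exists (fun y => L y 1); split; last first.
- have -> // := @lift_unique _ (L x0) (cst e) 0 connected_line (cL x0).
  + exact: cst_continuous.
  + by move=> t; rewrite pL cx0 pe.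
  + by have [_ -> _] := LP x0.
- by move=> y; rewrite pL minxx c1.
move=> x; apply: (@connected_constant _ (fun t => {for x, continuous (fun y => L y t)}) 0).
- exact: connected_line.
- move=> b; have [U [I [V [Q [[oU Ub oV tV UV] QP]]]]] := sheets (phi (c (x, Num.min 1 b))).
  have : nbhs (x, b) ((fun yt : X * R => phi (c (yt.1, Num.min 1 yt.2))) @^-1` U).
    by apply: cc2; apply: open_nbhs_nbhs.
  case=> -[A B] /= [Ax /nbhs_ballP[d /= d0 dB]] ABU.
  have {dB}ABU y t : A y -> ball b d t -> U (phi (c (y, Num.min 1 t))).
    by move=> Ay bt; apply: (ABU (y, t)); split => //=; apply: dB.
  have step t1 t2 : ball b d t1 -> ball b d t2 ->
      {for x, continuous (fun y => L y t1)} -> {for x, continuous (fun y => L y t2)}.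
    move=> b1 b2 cL1.
    have Ux : U (p (L x t1)) by rewrite pL; apply: ABU => //; exact: nbhs_singleton.
    have [i _ Vi] : (\bigcup_i V i) (L x t1) by rewrite -UV.
    have [VQ cQ Qp] := QP i.
    have nV : \forall y \near x, V i (L y t1).
      by apply: cL1; apply: open_nbhs_nbhs; split => //; exact: oV.
    (* a path from [t1] to [t2] defined on the whole line and staying between them *)
    pose k (t : R) := Num.max (Num.min t1 t2) (Num.min (Num.max t1 t2) (t1 + t * (t2 - t1))).
    have k0 : k 0 = t1.
      rewrite /k mul0r addr0 (@min_r _ _ (Num.max t1 t2) t1) ?le_max ?lexx // max_r //.
      by case: (leP t1 t2) => // /ltW.
    have k1 : k 1 = t2.
      rewrite /k mul1r addrC subrK (@min_r _ _ (Num.max t1 t2) t2);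
        last by rewrite le_max lexx orbT.
      by rewrite max_r // ge_min lexx orbT.
    have ck : continuous k.
      have cl : continuous (fun t : R => t1 + t * (t2 - t1)).
        by move=> t; apply: cvgD; [exact: cvg_cst|apply: cvgM; [exact: cvg_id|exact: cvg_cst]].
      have cm : continuous (fun t : R => Num.min (Num.max t1 t2) (t1 + t * (t2 - t1))).
        move=> t; exact: (continuous_comp (cl t) (@continuous_minr (Num.max t1 t2) _)).
      move=> t; exact: (continuous_comp (cm t) (@continuous_maxr (Num.min t1 t2) _)).
    have bk t : ball b d (k t).
      apply: (between_ball b1 b2); rewrite /k; first by rewrite le_max lexx.
      rewrite ge_max [X in X && _]ge_min [X in _ && X]ge_min lexx andbT.
      by rewrite le_max lexx.
    have LQ y : A y -> V i (L y t1) -> L y t2 = Q i (phi (c (y, Num.min 1 t2))).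
      move=> Ay Vy; rewrite -k1.
      apply: (@lift_unique _ (L y \o k) (fun t => Q i (phi (c (y, Num.min 1 (k t))))) 0).
      + exact: connected_line.
      + by move=> t; apply: continuous_comp; [exact: ck|exact: cL].
      + move=> t; apply: continuous_comp; last by apply: cQ; apply: ABU.
        exact: (continuous_comp (continuous_comp (ck t) (@continuous_minr 1 _)) (ccl y _)).
      + by move=> t; rewrite /= pL; have [_ ->] := VQ _ (ABU y (k t) Ay (bk t)).
      + by rewrite /= k0 -pL Qp.
    have cQx : {for x, continuous (fun y => Q i (phi (c (y, Num.min 1 t2))))}.
      apply: continuous_comp; first exact: ccr.
      by apply: cQ; apply: ABU => //; exact: nbhs_singleton.
    have LQx : L x t2 = Q i (phi (c (x, Num.min 1 t2))).
      by apply: LQ => //; exact: nbhs_singleton.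
    rewrite /prop_for /continuous_at LQx.
    apply: cvg_trans cQx; apply: near_eq_cvg.
    near=> y; rewrite LQ //; near: y => //.
  near=> z.
  have zd : ball b d z by near: z; exact: nbhsx_ballx.
  by split; apply: step => //; exact: ballxx.
- have -> : (fun y => L y 0) = cst e by apply/funext => y; have [] := LP y.
  exact: cst_continuous.
Unshelve. all: by end_near. Qed.

End Covering.

(** * The ideal simplex *)

Section IdealSimplex.
Variable (R : realType).

(** The topology of matrices is the product topology. *)
Lemma continuous_coord_mx (X : topologicalType) (m n : nat) (F : X -> 'M[R]_(m, n)) :
  (forall i j, continuous (fun x => F x i j)) -> continuous F.
Proof.
move=> cF x A [P MP PA]; rewrite nbhs_filterE /=.
have : \forall y \near x, forall i j, P i j (F y i j).
  apply: filter_forall => i; apply: filter_forall => j.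
  by apply: cF; exact: MP.
by apply: filterS => y Py; apply: PA.
Qed.

Lemma continuous_ideal_coord v : continuous (fun x : ideal_simplex R => set_val x 0 v).
Proof.
move=> x.
apply: (@continuous_comp _ _ _ (@set_val _ (ideal_simplex R)) (fun M : 'rV[R]_4 => M 0 v)).
  exact: initial_continuous.
exact: coord_continuous.
Qed.

Lemma continuous_to_ideal (X : topologicalType) (F : X -> ideal_simplex R) :
  (forall v, continuous (fun x => set_val (F x) 0 v)) -> continuous F.
Proof.
move=> cF; apply: continuous_comp_initial; apply: continuous_coord_mx => i j.
by rewrite ord1; exact: cF.
Qed.

Lemma ideal_ge0 (x : ideal_simplex R) v : 0 <= set_val x 0 v.
Proof. by have [[]] := set_valP x. Qed.

Lemma ideal_sum (x : ideal_simplex R) : \sum_v set_val x 0 v = 1.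
Proof. by have [[]] := set_valP x. Qed.

Lemma ideal_lt1 (x : ideal_simplex R) v : set_val x 0 v < 1.
Proof.
have [_ /(_ v)] := set_valP x; rewrite lt_neqAle => -> /=.
rewrite -(ideal_sum x) (bigD1 v) //= lerDl.
by apply: sumr_ge0 => w _; exact: ideal_ge0.
Qed.

Definition clamp (t : R) : R := Num.min 1 (Num.max 0 t).

Lemma clamp_ge0 t : 0 <= clamp t.
Proof. by rewrite /clamp le_min ler01 le_max lexx. Qed.

Lemma clamp_le1 t : clamp t <= 1.
Proof. by rewrite /clamp ge_min lexx. Qed.

Lemma clamp_le0 t : t <= 0 -> clamp t = 0.
Proof. by move=> t0; rewrite /clamp max_l // min_r. Qed.

Lemma clamp1 : clamp 1 = 1.
Proof. by rewrite /clamp max_r // minxx. Qed.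

Lemma continuous_clamp : continuous clamp.
Proof.
by move=> t; exact: (continuous_comp (@continuous_maxr R 0 t) (@continuous_minr R 1 _)).
Qed.

Definition segment_row (x0 x : 'rV[R]_4) t : 'rV[R]_4 :=
  \row_v (x0 0 v + clamp t * (x 0 v - x0 0 v)).

(** Deleting the vertices of a simplex, which are extreme points, leaves a convex
    set. *)
Lemma segment_ideal (x0 x : ideal_simplex R) t :
  ideal_simplex R (segment_row (set_val x0) (set_val x) t).
Proof.
have c0 := clamp_ge0 t; have c1 := clamp_le1 t.
split; first split.
- move=> v; rewrite mxE.
  have -> : set_val x0 0 v + clamp t * (set_val x 0 v - set_val x0 0 v) =
    (1 - clamp t) * set_val x0 0 v + clamp t * set_val x 0 v by ring.
  by rewrite addr_ge0 // mulr_ge0 ?subr_ge0 ?ideal_ge0.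
- rewrite (eq_bigr (fun v => set_val x0 0 v + clamp t * (set_val x 0 v - set_val x0 0 v)));
    last by move=> v _; rewrite mxE.
  by rewrite big_split /= -mulr_sumr sumrB !ideal_sum subrr mulr0 addr0.
- move=> v; rewrite mxE lt_eqF // -subr_gt0.
  have -> : 1 - (set_val x0 0 v + clamp t * (set_val x 0 v - set_val x0 0 v)) =
    (1 - clamp t) * (1 - set_val x0 0 v) + clamp t * (1 - set_val x 0 v) by ring.
  have b0 : 0 < 1 - set_val x 0 v by rewrite subr_gt0 ideal_lt1.
  have a0 : 0 < 1 - set_val x0 0 v by rewrite subr_gt0 ideal_lt1.
  move: a0 b0; move: (1 - set_val x0 0 v) (1 - set_val x 0 v) (clamp t) c0 c1 => a b c c0 c1 a0 b0.
  have [->|c_neq0] := eqVneq c 0; first by rewrite subr0 mul1r mul0r addr0.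
  apply: ltr_wpDl; first by rewrite mulr_ge0 ?subr_ge0 // ltW.
  by rewrite mulr_gt0 // lt_def c_neq0.
Qed.

Definition segment (x0 : ideal_simplex R) (xt : ideal_simplex R * R) : ideal_simplex R :=
  SigSub (mem_set (segment_ideal x0 xt.1 xt.2)).

Lemma segmentE x0 x t v :
  set_val (segment x0 (x, t)) 0 v = set_val x0 0 v + clamp t * (set_val x 0 v - set_val x0 0 v).
Proof. by rewrite /segment /= mxE. Qed.

Lemma ideal_eq (x y : ideal_simplex R) : (forall v, set_val x 0 v = set_val y 0 v) -> x = y.
Proof.
move=> xy; apply: val_inj; apply/rowP => v; exact: xy.
Qed.

Lemma continuous_segment x0 : continuous (segment x0).
Proof.
apply: continuous_to_ideal => v; rewrite /prop_for => xt.
have -> : (fun x => set_val (segment x0 x) 0 v) =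
    (fun xt => set_val x0 0 v + clamp xt.2 * (set_val xt.1 0 v - set_val x0 0 v)).
  by apply/funext => -[x t]; rewrite segmentE.
have cf : {for xt, continuous (@fst (ideal_simplex R) R)} by exact: cvg_fst.
have cs : {for xt, continuous (@snd (ideal_simplex R) R)} by exact: cvg_snd.
apply: cvgD; first exact: cvg_cst.
apply: cvgM; first exact: (continuous_comp cs (@continuous_clamp _)).
apply: cvgB; last exact: cvg_cst.
exact: (continuous_comp cf (@continuous_ideal_coord _ _)).
Qed.

Lemma segment_path x0 x : continuous (fun t => segment x0 (x, t)).
Proof.
move=> t; apply: (continuous_comp (f := fun t => (x, t))); last exact: continuous_segment.
exact: (cvg_pair (@cst_continuous _ _ _ _) (@cvg_id _ _)).
Qed.

Lemma segment0 x0 x t : t <= 0 -> segment x0 (x, t) = x0.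
Proof. by move=> t0; apply: ideal_eq => v; rewrite segmentE clamp_le0 // mul0r addr0. Qed.

Lemma segment1 x0 x : segment x0 (x, 1) = x.
Proof. by apply: ideal_eq => v; rewrite segmentE clamp1 mul1r addrC subrK. Qed.

Lemma segmentxx x0 t : segment x0 (x0, t) = x0.
Proof. by apply: ideal_eq => v; rewrite segmentE subrr mulr0 addr0. Qed.

Definition permute_row (s : 'S_4) (x : 'rV[R]_4) : 'rV[R]_4 := \row_v x 0 ((s^-1)%g v).

Lemma permute_ideal s (x : ideal_simplex R) : ideal_simplex R (permute_row s (set_val x)).
Proof.
split; first split.
- by move=> v; rewrite mxE; exact: ideal_ge0.
- rewrite -[RHS](ideal_sum x) [RHS](reindex_inj (@perm_inj _ (s^-1)%g)).
  by apply: eq_bigr => v _; rewrite mxE.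
- by move=> v; rewrite mxE lt_eqF // ideal_lt1.
Qed.

(** The affine map that glues two faces, extended to the whole simplex. *)
Definition permute s (x : ideal_simplex R) : ideal_simplex R :=
  SigSub (mem_set (permute_ideal s x)).

Lemma permuteE s x v : set_val (permute s x) 0 (s v) = set_val x 0 v.
Proof. by rewrite /permute /= mxE permK. Qed.

Lemma permute_uniq (s : 'S_4) (x y : ideal_simplex R) : (forall v, set_val y 0 (s v) =
  set_val x 0 v) -> y = permute s x.
Proof.
by move=> yx; apply: ideal_eq => v; rewrite -(permKV s v) yx permuteE.
Qed.

Lemma continuous_permute s : continuous (permute s).
Proof.
apply: continuous_to_ideal => v.
have -> : (fun x => set_val (permute s x) 0 v) = (fun x => set_val x 0 ((s^-1)%g v)).
  by apply/funext => x; rewrite /permute /= mxE.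
exact: continuous_ideal_coord.
Qed.

Lemma face_centre_ideal (f : 'I_4) :
  ideal_simplex R (\row_v if v == f then 0 else 3%:R^-1).
Proof.
split; first split.
- by move=> v; rewrite mxE; case: ifP => // _; rewrite invr_ge0 ler0n.
- rewrite (bigD1 f) //= mxE eqxx add0r.
  rewrite (eq_bigr (fun=> 3%:R^-1)) => [|v /negPf vf]; last by rewrite mxE vf.
  by rewrite sumr_const cardC1 card_ord -[_ *+ _]mulr_natr mulVf // pnatr_eq0.
- by move=> v; rewrite mxE lt_eqF //; case: ifP => _; rewrite ?ltr01 // invf_lt1 ?ltr0n // ltr1n.
Qed.

Definition face_centre f : ideal_simplex R := SigSub (mem_set (face_centre_ideal f)).

Lemma face_centre0 f : set_val (face_centre f) 0 f = 0.
Proof. by rewrite /face_centre /= mxE eqxx. Qed.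

End IdealSimplex.

(** * Ideal tetrahedra of the universal cover *)

Section Tetrahedra.
Variables (R : realType) (n : nat) (T : face_pairing n).
Variables (M : topologicalType) (phi : 'I_n -> ideal_simplex R -> M).
Variables (E : topologicalType) (p : E -> M) (e0 : E).
Hypothesis hT : ideal_triangulation T phi.
Hypothesis hp : universal_cover R E M p.

Let cp : continuous p. Proof. by have [] := hp. Qed.
Let cov : forall x, exists U : set M, [/\ open U, U x & evenly_covered p U].
Proof. by have [] := hp. Qed.

Lemma continuous_characteristic_map j : continuous (phi j).
Proof. by apply/continuousP => U oU; have [_ _ /(_ U)[h _]] := hT; exact: h. Qed.

Lemma tet_exists j x e : p e = phi j x ->
  exists s : tet R n E, [/\ is_tet phi p s, s.1 = j & s.2 x = e].
Proof.
move=> pe.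
have [s [cs ps sx]] := @lift_contractible R E M p e0 cov _ (segment x) (phi j) x e
  (@continuous_segment R x) (@continuous_characteristic_map j) (@segment0 R x) (@segment1 R x)
  (@segmentxx R x) pe.
by exists (j, s).
Qed.

Lemma lift_unique_path (f g : R -> E) : continuous f -> continuous g ->
  (forall t, p (f t) = p (g t)) -> f 0 = g 0 -> f 1 = g 1.
Proof.
move=> cf cg pfg fg0.
by apply: (@lift_unique E M p e0 cov _ f g 0); first exact: connected_line.
Qed.

(** Ideal simplices are connected by segments, so lifts agreeing at one point agree
    everywhere. *)
Lemma tet_unique (s t : tet R n E) x : is_tet phi p s -> is_tet phi p t -> s.1 = t.1 ->
  s.2 x = t.2 x -> s = t.
Proof.
move=> [cs ps] [ct pt] st stx.
rewrite (surjective_pairing s) (surjective_pairing t) st; congr pair.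
apply/funext => y; rewrite -(segment1 x y).
apply: (@lift_unique_path (fun u => s.2 (segment x (y, u))) (fun u => t.2 (segment x (y, u)))).
- by move=> u; exact: (continuous_comp (@segment_path R x _ u) (cs _)).
- by move=> u; exact: (continuous_comp (@segment_path R x _ u) (ct _)).
- by move=> u; rewrite ps pt st.
- by rewrite !segment0.
Qed.

Lemma characteristic_map_glued j f (x y : ideal_simplex R) : set_val x 0 f = 0 ->
  (forall v, set_val y 0 (fp_perm T j f v) = set_val x 0 v) ->
  phi (fp_adj T j f) y = phi j x.
Proof.
move=> xf yx; have [_ h _] := hT; apply/esym/h.
by apply: (si_step xf yx); exact: si_refl.
Qed.

(** The neighbour is the lift of the adjacent tetrahedron that agrees with [s] at the
    centre of the face; the face being convex, it agrees with [s] on the whole face. *)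
Lemma neighbour_exists (s : tet R n E) f : is_tet phi p s ->
  exists t, share_face T phi p s t f.
Proof.
move=> ts; have [cs ps] := ts; set sg := fp_perm T s.1 f.
pose x := face_centre R f; have xf : set_val x 0 f = 0 := face_centre0 R f.
have [|t [tt t1 tx]] := @tet_exists (fp_adj T s.1 f) (permute sg x) (s.2 x).
  by rewrite ps -(characteristic_map_glued xf (permuteE sg x)).
exists t; split => // z y zf yz; rewrite (permute_uniq yz).
have [ct pt] := tt; rewrite -(segment1 x z).
apply: (@lift_unique_path (fun u => t.2 (permute sg (segment x (z, u))))
  (fun u => s.2 (segment x (z, u)))).
- move=> u; exact: (continuous_comp (continuous_comp (@segment_path R x z u)
    (@continuous_permute R sg _)) (ct _)).
- by move=> u; exact: (continuous_comp (@segment_path R x _ u) (cs _)).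
- move=> u; rewrite pt ps t1; apply: characteristic_map_glued; last by move=> v; rewrite permuteE.
  by rewrite segmentE zf xf subrr mulr0 addr0.
- by rewrite !segment0.
Qed.

(** The covering map is a local homeomorphism and the base has the quotient topology,
    so the universal cover has the topology coherent with its tetrahedra. *)
Lemma open_from_tets (U : set E) :
  (forall s, is_tet phi p s -> open (s.2 @^-1` U)) -> open U.
Proof.
move=> oU; rewrite openE => e Ue; rewrite /interior.
have [W [I [V [Q [[oW We oV tV WV] QP]]]]] := sheets e0 cov (p e).
have [i _ Vi] : (\bigcup_i V i) e by rewrite -WV.
have [VQ cQ Qp] := QP i.
pose P := [set m | W m /\ U (Q i m)].
have oP : open P.
  have [_ _ /(_ P)[_ h]] := hT; apply: h => j; rewrite openE => x [Wx Ux]; rewrite /interior.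
  have [VQx pQx] := VQ _ Wx.
  have [s [ts sj sx]] := tet_exists pQx.
  have [cs ps] := ts.
  have nU : nbhs x (s.2 @^-1` U).
    by apply: open_nbhs_nbhs; split; [exact: oU|rewrite /= sx].
  have nV : nbhs x (s.2 @^-1` (V i)).
    by apply: cs; apply: open_nbhs_nbhs; split; [exact: oV|rewrite sx].
  near=> y.
  have sUy : U (s.2 y) by near: y.
  have sVy : V i (s.2 y) by near: y.
  have pE : phi j y = p (s.2 y) by rewrite ps sj.
  split; last by rewrite pE Qp.
  by rewrite pE; have : (p @^-1` W) (s.2 y); [rewrite WV; exists i|].
have : nbhs e (V i `&` p @^-1` P).
  apply: filterI; first by apply: open_nbhs_nbhs.
  by apply: cp; apply: open_nbhs_nbhs; split => //; split => //; rewrite Qp.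
by apply: filterS => z [Vz [Wz]]; rewrite Qp.
Unshelve. all: by end_near. Qed.

(** Connectedness of the tetrahedra under face sharing, as an induction principle:
    the points lying in a tetrahedron that satisfies [C] form an open and closed set,
    because tetrahedra with a common point are linked through faces. *)
Lemma tets_connected (C : tet R n E -> Prop) s0 : is_tet phi p s0 -> C s0 ->
  (forall s t f, C s -> share_face T phi p s t f -> C t) ->
  forall t, is_tet phi p t -> C t.
Proof.
move=> ts0 C0 Cstep.
have Cglue a b : simplex_identified T a b -> forall s t, is_tet phi p s -> C s ->
    s.1 = a.1 -> is_tet phi p t -> t.1 = b.1 -> s.2 a.2 = t.2 b.2 -> C t.
  elim=> {a b} [a|j f x y b xf yx _ IH] s t ts Cs s1 tt t1 st.
    by rewrite -(tet_unique ts tt _ st) // s1 t1.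
  have [u su] := neighbour_exists f ts.
  have [_ tu u1 uy] := su; move: s1 st => /= s1 st.
  apply: (IH u) => //; [exact: (Cstep s u f)|by rewrite u1 s1|].
  by rewrite -st /=; apply: uy; [rewrite xf|move=> v; rewrite s1 yx].
(* the union of the tetrahedra satisfying [C] *)
pose U := [set e | exists s x, [/\ is_tet phi p s, C s & s.2 x = e]].
have UC t x : is_tet phi p t -> U (t.2 x) -> C t.
  move=> tt [s [y [ts Cs sy]]].
  have [_ h _] := hT; have [cs ps] := ts; have [ct pt] := tt.
  have /h syn : phi s.1 y = phi t.1 x by rewrite -ps -pt sy.
  exact: (Cglue _ _ syn s t).
have CU t x : is_tet phi p t -> C t -> U (t.2 x) by move=> tt Ct; exists t, x.
have oU : open U.
  apply: open_from_tets => s ts; have [Cs|nCs] := pselect (C s).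
    have -> : s.2 @^-1` U = setT by rewrite predeqE => x; split => // _; exact: CU.
    exact: openT.
  have -> : s.2 @^-1` U = set0 by rewrite predeqE => x; split => // /(UC _ _ ts).
  exact: open0.
have oNU : open (~` U).
  apply: open_from_tets => s ts; have [Cs|nCs] := pselect (C s).
    by have -> : s.2 @^-1` (~` U) = set0; [rewrite predeqE => x; split => //; apply;
      exact: CU|exact: open0].
  by have -> : s.2 @^-1` (~` U) = setT; [rewrite predeqE => x; split => //
    _ /(UC _ _ ts)|exact: openT].
move=> t tt; pose x := face_centre R ord0.
apply: (UC t x) => //.
have [_ _ [paths _]] := hp; have [g [cg g0 g1]] := paths (s0.2 x) (t.2 x).
have cA : connected (g @` `[0, 1]).
  by apply: connected_continuous_connected => //; exact: segment_connected.
have /(_ _ _ _) AU := cA (g @` `[0, 1] `&` U).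
suff : (g @` `[0, 1] `&` U) (t.2 x) by case.
rewrite AU.
- by exists 1 => //=; rewrite in_itv /= ler01 lexx.
- exists (s0.2 x); split; last exact: CU.
  by exists 0 => //=; rewrite in_itv /= ler01 lexx.
- by exists U.
- by exists U => //; rewrite -[U]setCK; exact: open_closedC.
Qed.

Lemma tet_through (e : E) : exists (s : tet R n E) x, is_tet phi p s /\ s.2 x = e.
Proof.
have [h _ _] := hT; have [j [x jx]] := h (p e).
by have [s [ts _ sx]] := tet_exists (esym jx); exists s, x.
Qed.

Lemma tet_deck tau (s : tet R n E) : deck_transformation p tau -> is_tet phi p s ->
  is_tet phi p (tet_act tau s).
Proof.
move=> [ctau [ptau _]] [cs ps]; split => [x|x] /=; last by rewrite ptau ps.
exact: (continuous_comp (cs x) (ctau _)).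
Qed.

End Tetrahedra.

(** * Frames of C^2 and hyperbolic distance *)

Section Frames.
Variable R : realType.
Local Notation C := R[i].
Local Notation vec := 'cV[C]_2.
Local Notation frame := (vec * vec)%type.

Definition cabs (z : C) : R := complex.Re `|z|.

Lemma cabsE (z : C) : cabs z = Num.sqrt (complex.Re z ^+ 2 + complex.Im z ^+ 2).
Proof. by rewrite /cabs normc_def. Qed.

Lemma cabs_sqr (z : C) : cabs z ^+ 2 = complex.Re z ^+ 2 + complex.Im z ^+ 2.
Proof. by rewrite cabsE sqr_sqrtr // addr_ge0 // sqr_ge0. Qed.

Lemma cabs_ge0 z : 0 <= cabs z.
Proof. by rewrite cabsE sqrtr_ge0. Qed.

Lemma cabsC z : (cabs z)%:C = `|z|.
Proof. by rewrite /cabs normc_def. Qed.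

Lemma cabsM x y : cabs (x * y) = cabs x * cabs y.
Proof. by apply: complexI; rewrite rmorphM /= !cabsC normrM. Qed.

Lemma cabsV x : cabs x^-1 = (cabs x)^-1.
Proof. by apply: complexI; rewrite fmorphV /= !cabsC normfV. Qed.

Lemma cabsN x : cabs (- x) = cabs x.
Proof. by rewrite /cabs normrN. Qed.

Lemma cabs0P x : (cabs x == 0) = (x == 0).
Proof. by rewrite -(inj_eq (@complexI R)) cabsC rmorph0 normr_eq0. Qed.

Lemma cabs_gt0 x : (0 < cabs x) = (x != 0).
Proof. by rewrite lt_def cabs_ge0 andbT cabs0P. Qed.

Lemma cabs1 : cabs 1 = 1.
Proof. by apply: complexI; rewrite cabsC normr1. Qed.

Lemma cabs_real (x : R) : cabs (x%:C) = `|x|.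
Proof. by rewrite cabsE /= expr0n addr0 sqrtr_sqr. Qed.

Lemma cabsD x y : cabs (x + y) <= cabs x + cabs y.
Proof. by rewrite -lecR rmorphD /= !cabsC ler_normD. Qed.

Definition cdet (a b : vec) : C := a 0 0 * b 1 0 - a 1 0 * b 0 0.

Lemma det_mx2 (A : 'M[C]_2) : \det A = A 0 0 * A 1 1 - A 1 0 * A 0 1.
Proof.
rewrite (expand_det_col _ 0) !big_ord_recl big_ord0 addr0 /cofactor /= !det_mx11 !mxE /=.
rewrite expr0 mul1r expr1 mulN1r mulrN; congr (_ * A _ _ - A _ _ * A _ _); exact: val_inj.
Qed.

Lemma cdetE (a b : vec) : \det (row_mx a b : 'M[C]_2) = cdet a b.
Proof.
have l i : (row_mx a b : 'M[C]_2) i 0 = a i 0.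
  by rewrite -[RHS](row_mxEl _ b); congr (row_mx a b i _); apply: val_inj.
have r i : (row_mx a b : 'M[C]_2) i 1 = b i 0.
  by rewrite -[RHS](row_mxEr a); congr (row_mx a b i _); apply: val_inj.
by rewrite det_mx2 !l !r.
Qed.

Definition frame_det (g : frame) : C := cdet g.1 g.2.

(** Twice the product of the determinants times the hyperbolic cosine of the distance
    of the two points, see [hdist_frame_point]. *)
Definition frame_cross (g h : frame) : R :=
  cabs (cdet g.1 h.1) ^+ 2 + cabs (cdet g.1 h.2) ^+ 2 +
  (cabs (cdet g.2 h.1) ^+ 2 + cabs (cdet g.2 h.2) ^+ 2).

(** log (2 cosh d), where d is the hyperbolic distance of the two points. *)
Definition frame_len (g h : frame) : R := ln (frame_cross g h / (cabs (frame_det g) *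
  cabs (frame_det h))).

Lemma cdetC a b : cdet a b = - cdet b a.
Proof. by rewrite /cdet; ring. Qed.

Lemma cdetZl k a b : cdet (k *: a) b = k * cdet a b.
Proof. by rewrite /cdet !mxE; ring. Qed.

Lemma cdetZr k a b : cdet a (k *: b) = k * cdet a b.
Proof. by rewrite /cdet !mxE; ring. Qed.

Lemma cdetvv a : cdet a a = 0.
Proof. by rewrite /cdet; ring. Qed.

Lemma cdet_mul (A : 'M[C]_2) a b : cdet (A *m a) (A *m b) = \det A * cdet a b.
Proof.
rewrite det_mx2 /cdet !mxE !big_ord_recl !big_ord0 !addr0.
have -> : lift ord0 ord0 = 1 :> 'I_2 by apply: val_inj.
by have -> : ord0 = 0 :> 'I_2 by []; ring.
Qed.

Lemma frame_crossC g h : frame_cross g h = frame_cross h g.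
Proof.
by rewrite /frame_cross !(cdetC h.1) !(cdetC h.2) !cabsN; ring.
Qed.

Lemma frame_cross_ge0 g h : 0 <= frame_cross g h.
Proof. by rewrite /frame_cross !addr_ge0 // sqr_ge0. Qed.

Lemma frame_lenC g h : frame_len g h = frame_len h g.
Proof. by rewrite /frame_len frame_crossC [cabs (frame_det g) * _]mulrC. Qed.

Lemma cabs_cauchy (x y a b : C) :
  cabs (x * a + y * b) ^+ 2 <= (cabs x ^+ 2 + cabs y ^+ 2) * (cabs a ^+ 2 + cabs b ^+ 2).
Proof.
have le : cabs (x * a + y * b) <= cabs x * cabs a + cabs y * cabs b.
  by rewrite -!cabsM cabsD.
apply: (@le_trans _ _ ((cabs x * cabs a + cabs y * cabs b) ^+ 2)).
  by rewrite ler_sqr ?nnegrE ?addr_ge0 ?mulr_ge0 ?cabs_ge0.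
rewrite -subr_ge0.
have -> : (cabs x ^+ 2 + cabs y ^+ 2) * (cabs a ^+ 2 + cabs b ^+ 2) -
  (cabs x * cabs a + cabs y * cabs b) ^+ 2 = (cabs x * cabs b - cabs y * cabs a) ^+ 2 by ring.
exact: sqr_ge0.
Qed.

(** The Pluecker relation expresses each determinant det(g_i, k_j) det(h_1, h_2)
    through the determinants with the vectors of [h]; the Cauchy-Schwarz inequality
    then gives submultiplicativity. *)
Lemma frame_crossM g h k : frame_cross g k * cabs (frame_det h) ^+ 2 <= frame_cross g h *
  frame_cross h k.
Proof.
have le a b : cabs (cdet a b) ^+ 2 * cabs (frame_det h) ^+ 2 <=
    (cabs (cdet a h.1) ^+ 2 + cabs (cdet a h.2) ^+ 2) *
    (cabs (cdet h.1 b) ^+ 2 + cabs (cdet h.2 b) ^+ 2).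
  rewrite -exprMn -cabsM.
  have -> : cdet a b * frame_det h = cdet h.2 b * (- cdet a h.1) + cdet h.1 b * cdet a h.2.
    by rewrite /frame_det /cdet; ring.
  rewrite -(cabsN (cdet a h.1)) mulrC [X in _ <= _ * X]addrC mulrC [X in _ <= X]mulrC.
  exact: cabs_cauchy.
have := lerD (lerD (le g.1 k.1) (le g.1 k.2)) (lerD (le g.2 k.1) (le g.2 k.2)).
rewrite -!mulrDl -!mulrDr /frame_cross => h1; apply: le_trans h1 _.
by rewrite -mulrDl [X in _ * X <= _]addrACA.
Qed.

Lemma frame_cross_gg g : frame_cross g g = 2 * cabs (frame_det g) ^+ 2.
Proof.
have c0 : cabs 0 = 0 by apply/eqP; rewrite cabs0P.
rewrite /frame_cross !cdetvv (cdetC g.2) cabsN c0 /frame_det expr0n /= add0r addr0.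
by rewrite mulr_natl mulr2n.
Qed.

Lemma frame_cross_gt0 g h : frame_det g != 0 -> frame_det h != 0 -> 0 < frame_cross g h.
Proof.
move=> g0 h0; have := frame_crossM g h g; rewrite frame_cross_gg (frame_crossC h) => le.
rewrite lt_def frame_cross_ge0 andbT; apply/eqP => s0; move: le; rewrite s0 mul0r leNgt.
by rewrite mulr_gt0 // ?mulr_gt0 // ?exprn_gt0 ?cabs_gt0 // ltr0n.
Qed.

Lemma frame_len_triangle g h k : frame_det g != 0 -> frame_det h != 0 -> frame_det k != 0 ->
  frame_len g k <= frame_len g h + frame_len h k.
Proof.
move=> g0 h0 k0; rewrite /frame_len.
have [gp hp kp] : [/\ 0 < cabs (frame_det g), 0 < cabs (frame_det h) & 0 < cabs (frame_det k)].
  by rewrite !cabs_gt0.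
have sp1 := frame_cross_gt0 g0 h0; have sp2 := frame_cross_gt0 h0 k0;
  have sp3 := frame_cross_gt0 g0 k0.
rewrite -lnM ?posrE ?divr_gt0 ?mulr_gt0 // ler_ln ?posrE ?mulr_gt0 ?divr_gt0 ?mulr_gt0 //.
rewrite mulf_div ler_pdivlMr ?mulr_gt0 // mulrAC ler_pdivrMr ?mulr_gt0 //.
have := frame_crossM g h k.
move: (frame_cross g k) (frame_cross g h) (frame_cross h k) (cabs _) (cabs _) (cabs _) gp hp kp => a b c x y z x0 y0 z0 le.
have -> : a * (z * y * (y * x)) = (a * y ^+ 2) * (z * x) by ring.
  by rewrite ler_pM2r ?mulr_gt0.
all: by rewrite invr_gt0 mulr_gt0.
Qed.

Lemma frame_len_scale g h k : k != 0 -> frame_len g (k *: h.1, k *: h.2) = frame_len g h.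
Proof.
move=> k0; rewrite /frame_len /frame_cross /frame_det /= !cdetZr !cdetZl !cabsM; congr ln.
have kp : cabs k != 0 by rewrite cabs0P.
rewrite !exprMn -!mulrDr.
set s := _ + _ + _; set x := cabs (cdet g.1 g.2); set y := cabs (cdet h.1 h.2).
rewrite (_ : x * _ = cabs k ^+ 2 * (x * y)); last by ring.
by rewrite -mulf_div divff ?mul1r // expf_neq0.
Qed.

Definition frame_act (A : 'M[C]_2) (g : frame) : frame := (A *m g.1, A *m g.2).

Lemma frame_len_act A g h : \det A = 1 -> frame_len (frame_act A g) (frame_act A h) = frame_len g h.
Proof. by move=> A1; rewrite /frame_len /frame_cross /frame_det /frame_act /= !cdet_mul A1 !mul1r. Qed.

Lemma frame_det_act A g : \det A = 1 -> frame_det (frame_act A g) = frame_det g.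
Proof. by move=> A1; rewrite /frame_det /frame_act /= cdet_mul A1 mul1r. Qed.

(** The Pluecker relation again, now in the form
    det(g) det(h) = det(g_1, h_1) det(g_2, h_2) - det(g_1, h_2) det(g_2, h_1).
    This is cosh d >= 1. *)
Lemma frame_cross_ge_det g h : 2 * (cabs (frame_det g) * cabs (frame_det h)) <= frame_cross g h.
Proof.
have -> : cabs (frame_det g) * cabs (frame_det h) = cabs (cdet g.1 h.1 * cdet g.2 h.2 +
    - (cdet g.1 h.2 * cdet g.2 h.1)).
  by rewrite -cabsM /frame_det /cdet; congr cabs; ring.
apply: (@le_trans _ _ (2 * (cabs (cdet g.1 h.1 * cdet g.2 h.2) +
    cabs (- (cdet g.1 h.2 * cdet g.2 h.1))))); first by rewrite ler_pM2l ?ltr0n // cabsD.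
rewrite cabsN !cabsM /frame_cross -subr_ge0.
set a := cabs _; set b := cabs _; set c := cabs _; set d := cabs _.
have -> : a ^+ 2 + b ^+ 2 + (c ^+ 2 + d ^+ 2) - 2 * (a * d + b * c) =
  (a - d) ^+ 2 + (b - c) ^+ 2 by ring.
by rewrite addr_ge0 // sqr_ge0.
Qed.

Definition frame_herm (g : frame) : 'M[C]_2 := g.1 *m adjoint g.1 + g.2 *m adjoint g.2.
(** The second vector may vanish: a frame [(w, 0)] then represents the ideal point of
    [w], so that points and ideal points share the same formulas. *)
Definition frame_point (g : frame) : 'rV[R]_3 := unherm (frame_herm g).
Definition frame_trace (g : frame) : R :=
  cabs (g.1 0 0) ^+ 2 + cabs (g.1 1 0) ^+ 2 + (cabs (g.2 0 0) ^+ 2 + cabs (g.2 1 0) ^+ 2).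

Lemma frame_hermE g a b : frame_herm g a b = g.1 a 0 * conjc (g.1 b 0) + g.2 a 0 * conjc (g.2 b 0).
Proof. by rewrite /frame_herm /adjoint !mxE !big_ord_recl !big_ord0 !addr0 !mxE. Qed.

Lemma conjc_mul (z : C) : z * conjc z = (cabs z ^+ 2)%:C.
Proof. by rewrite rmorphXn /= cabsC sqr_normc. Qed.

Lemma sum3 (F : 'I_3 -> R) : \sum_k F k = F 0 + F 1 + F 2%:R.
Proof.
rewrite !big_ord_recl big_ord0 addr0 addrA.
by congr (F _ + F _ + F _); apply: val_inj.
Qed.

Lemma cabs_cdet_sqr a b : cabs (cdet a b) ^+ 2 =
  (complex.Re (a 0 0) * complex.Re (b 1 0) - complex.Im (a 0 0) * complex.Im (b 1 0) -
   (complex.Re (a 1 0) * complex.Re (b 0 0) - complex.Im (a 1 0) * complex.Im (b 0 0))) ^+ 2 +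
  (complex.Re (a 0 0) * complex.Im (b 1 0) + complex.Im (a 0 0) * complex.Re (b 1 0) -
   (complex.Re (a 1 0) * complex.Im (b 0 0) + complex.Im (a 1 0) * complex.Re (b 0 0))) ^+ 2.
Proof.
by rewrite cabs_sqr /cdet; case: (a 0 0) (a 1 0) (b 0 0) (b 1 0) => [? ?] [? ?] [? ?] [? ?].
Qed.

Lemma frame_herm01 g : frame_herm g 0 1 = Complex
  (complex.Re (g.1 0 0) * complex.Re (g.1 1 0) + complex.Im (g.1 0 0) * complex.Im (g.1 1 0) +
   (complex.Re (g.2 0 0) * complex.Re (g.2 1 0) + complex.Im (g.2 0 0) * complex.Im (g.2 1 0)))
  (complex.Im (g.1 0 0) * complex.Re (g.1 1 0) - complex.Re (g.1 0 0) * complex.Im (g.1 1 0) +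
   (complex.Im (g.2 0 0) * complex.Re (g.2 1 0) - complex.Re (g.2 0 0) * complex.Im (g.2 1 0))).
Proof.
rewrite frame_hermE; case: (g.1 0 0) (g.1 1 0) (g.2 0 0) (g.2 1 0) => [a b] [c d] [e f] [k l] /=.
by apply/eqP; rewrite eq_complex /= !mulrN !opprK ![- _ + _]addrC !eqxx.
Qed.

Lemma frame_herm_diag g v : frame_herm g v v = (cabs (g.1 v 0) ^+ 2 + cabs (g.2 v 0) ^+ 2)%:C.
Proof. by rewrite frame_hermE !conjc_mul rmorphD. Qed.

Lemma frame_herm10 g : frame_herm g 1 0 = conjc (frame_herm g 0 1).
Proof. by rewrite !frame_hermE rmorphD !rmorphM /= !conjcK mulrC [X in _ + X]mulrC. Qed.

Lemma frame_pointE g : [/\ frame_point g 0 0 = 2 * complex.Re (frame_herm g 0 1) / frame_trace g,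
  frame_point g 0 1 = 2 * complex.Im (frame_herm g 0 1) / frame_trace g &
  frame_point g 0 2%:R = (cabs (g.1 0 0) ^+ 2 + cabs (g.2 0 0) ^+ 2 -
    (cabs (g.1 1 0) ^+ 2 + cabs (g.2 1 0) ^+ 2)) / frame_trace g].
Proof.
have tg : complex.Re (frame_herm g 0 0 + frame_herm g 1 1) = frame_trace g.
  by rewrite !frame_herm_diag -rmorphD /= /frame_trace addrACA.
split; rewrite /frame_point /unherm mxE /= tg // !frame_herm_diag -rmorphB /=.
by [].
Qed.

Lemma dotE (x y : 'rV[R]_3) :
  dot x y = x 0 0 * y 0 0 + x 0 1 * y 0 1 + x 0 2%:R * y 0 2%:R.
Proof. exact: sum3. Qed.

(** Up to a factor, both sides are the polar form of the determinant on hermitian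
    matrices. *)
Lemma dot_frame_point g h : frame_trace g != 0 -> frame_trace h != 0 ->
  1 - dot (frame_point g) (frame_point h) = 2 * frame_cross g h / (frame_trace g * frame_trace h).
Proof.
move=> g0 h0; rewrite dotE.
have [] := frame_pointE g; have [] := frame_pointE h.
move: (frame_point g) (frame_point h) => x y -> -> -> -> -> ->.
apply: (@mulIf _ (frame_trace g * frame_trace h)); first by rewrite mulf_neq0.
rewrite divfK ?mulf_neq0 //.
have -> : forall a b c d e f : R, (1 - (a / frame_trace g * (b / frame_trace h) +
  c / frame_trace g * (d / frame_trace h) +
  e / frame_trace g * (f / frame_trace h))) * (frame_trace g * frame_trace h) = frame_trace g *
    frame_trace h - a * b - c * d - e * f.
  by move=> *; field; rewrite g0 h0.
rewrite !frame_herm01 /= /frame_trace /frame_cross !cabs_cdet_sqr !cabs_sqr.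
move: (complex.Re (g.1 0 0)) (complex.Re (g.1 1 0)) (complex.Re (g.2 0 0)) (complex.Re (g.2 1 0))
 (complex.Re (h.1 0 0)) (complex.Re (h.1 1 0)) (complex.Re (h.2 0 0)) (complex.Re (h.2 1 0))
 (complex.Im (g.1 0 0)) (complex.Im (g.1 1 0)) (complex.Im (g.2 0 0)) (complex.Im (g.2 1 0))
 (complex.Im (h.1 0 0)) (complex.Im (h.1 1 0)) (complex.Im (h.2 0 0)) (complex.Im (h.2 1 0)).
by move=> *; ring.
Qed.

Lemma herm_frame_point g : frame_trace g != 0 -> herm (frame_point g) =
  (2 / frame_trace g)%:C *: frame_herm g.
Proof.
move=> g0; have [] := frame_pointE g; move: (frame_point g) => x x0 x1 x2.
have scal (c a b : R) : c%:C * Complex a b = Complex (c * a) (c * b).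
  by apply/eqP; rewrite eq_complex /= !mul0r subr0 addr0 !eqxx.
have tE : frame_trace g = cabs (g.1 0 0) ^+ 2 + cabs (g.1 1 0) ^+ 2 +
  (cabs (g.2 0 0) ^+ 2 + cabs (g.2 1 0) ^+ 2) by [].
have ord2 (i : 'I_2) : i = 0 \/ i = 1.
  by case: i => [[|[|//]] Hi]; [left|right]; apply: val_inj.
have E01 : Complex (x 0 0) (x 0 1) = (2 / frame_trace g)%:C * frame_herm g 0 1.
  by rewrite x0 x1; case: (frame_herm g 0 1) => a b /=; rewrite scal; congr Complex; ring.
have E10 : Complex (x 0 0) (- x 0 1) = (2 / frame_trace g)%:C * frame_herm g 1 0.
  rewrite x0 x1 frame_herm10; case: (frame_herm g 0 1) => a b /=; rewrite scal; congr Complex; ring.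
apply/matrixP => i j; rewrite [LHS]mxE [RHS]mxE.
case: (ord2 i) => ->; case: (ord2 j) => -> /=; rewrite ?E01 ?E10 //.
- rewrite frame_herm_diag -rmorphM; congr Complex; rewrite x2; apply: (mulIf g0).
  by rewrite mulrDl mul1r divfK // [2 / _ * _]mulrAC divfK // tE; ring.
- rewrite frame_herm_diag -rmorphM; congr Complex; rewrite x2; apply: (mulIf g0).
  by rewrite mulrBl mul1r divfK // [2 / _ * _]mulrAC divfK // tE; ring.
Qed.

Lemma unhermZ (c : R) X : c != 0 -> unherm (c%:C *: X) = unherm X :> 'rV[R]_3.
Proof.
move=> c0.
have Rs (z : C) : complex.Re (c%:C * z) = c * complex.Re z by case: z => a b /=;
  rewrite mul0r subr0.
have Is (z : C) : complex.Im (c%:C * z) = c * complex.Im z by case: z => a b /=;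
  rewrite mul0r addr0.
have sc (a b : R) : (c * a) / (c * b) = a / b by rewrite -mulf_div divff // mul1r.
apply/rowP => k; rewrite ![LHS]mxE ![RHS]mxE ![(c%:C *: X) _ _]mxE -mulrDr -mulrBr !Rs Is.
by case: ifP => _; [|case: ifP => _]; rewrite ?[2 * (c * _)]mulrCA sc.
Qed.

Lemma frame_herm_act A g : A *m frame_herm g *m adjoint A = frame_herm (frame_act A g).
Proof.
have adjM (w : vec) : adjoint (A *m w) = adjoint w *m adjoint A.
  by rewrite /adjoint map_mxM trmx_mul.
by rewrite /frame_herm /frame_act /= !adjM mulmxDr mulmxDl !mulmxA.
Qed.

Lemma psl_act_frame_point A g : frame_trace g != 0 -> psl_act A (frame_point g) =
  frame_point (frame_act A g).
Proof.
move=> g0; rewrite /psl_act herm_frame_point // -scalemxAr -scalemxAl frame_herm_act.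
by rewrite unhermZ // mulf_neq0 ?invr_eq0 // pnatr_eq0.
Qed.

Lemma frame_trace_gt0 g : frame_det g != 0 -> 0 < frame_trace g.
Proof.
move=> g0; rewrite lt_def /frame_trace !addr_ge0 ?sqr_ge0 // andbT.
apply: contra g0 => t0.
rewrite !paddr_eq0 ?addr_ge0 ?sqr_ge0 // !expf_eq0 /= !cabs0P in t0.
by case/andP: t0 => /andP[/eqP a0 /eqP b0] _; rewrite /frame_det /cdet a0 b0 !mul0r subr0.
Qed.

Lemma frame_point_H3 g : frame_det g != 0 -> H3 (frame_point g).
Proof.
move=> g0; have t0 := frame_trace_gt0 g0.
rewrite /H3 /= -subr_gt0 dot_frame_point ?gt_eqF // frame_cross_gg.
have d0 : 0 < cabs (frame_det g) ^+ 2 by rewrite exprn_gt0 // cabs_gt0.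
by rewrite divr_gt0 // mulr_gt0 // ?ltr0n // mulr_gt0 // ltr0n.
Qed.

Lemma hdist_frame_point g h : frame_det g != 0 -> frame_det h != 0 ->
  hdist (frame_point g) (frame_point h) = arcosh (frame_cross g h / (2 * (cabs (frame_det g) *
    cabs (frame_det h)))).
Proof.
move=> g0 h0; have tg := frame_trace_gt0 g0; have th := frame_trace_gt0 h0.
have [tg0 th0] : frame_trace g != 0 /\ frame_trace h != 0 by rewrite !gt_eqF.
move: (dot_frame_point tg0 th0) (dot_frame_point tg0 tg0) (dot_frame_point th0 th0).
rewrite /hdist; move: (frame_point g) (frame_point h) => x y -> -> ->; rewrite !frame_cross_gg.
have dg : 0 < cabs (frame_det g) by rewrite cabs_gt0.
have dh : 0 < cabs (frame_det h) by rewrite cabs_gt0.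
have -> : 2 * (2 * cabs (frame_det g) ^+ 2) / (frame_trace g * frame_trace g) *
  (2 * (2 * cabs (frame_det h) ^+ 2) / (frame_trace h * frame_trace h)) =
  (4 * (cabs (frame_det g) * cabs (frame_det h)) / (frame_trace g * frame_trace h)) ^+ 2.
  by field; rewrite !gt_eqF.
rewrite sqrtr_sqr ger0_norm; last by rewrite divr_ge0 ?mulr_ge0 ?ler0n // ltW.
by congr arcosh; field; rewrite !gt_eqF.
Qed.

Lemma arcosh_bounds (t : R) : 1 <= t -> 0 <= arcosh t <= ln (2 * t).
Proof.
move=> t1; have t0 : 0 < t by apply: lt_le_trans t1; rewrite ltr01.
have s0 : 0 <= Num.sqrt (t ^+ 2 - 1) by exact: sqrtr_ge0.
have st : Num.sqrt (t ^+ 2 - 1) <= t.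
  rewrite -[leRHS](ger0_norm (ltW t0)) -sqrtr_sqr ler_sqrt ?sqr_ge0 //.
  by rewrite gerBl ler01.
rewrite /arcosh; apply/andP; split.
  by rewrite ln_ge0 // (le_trans t1) // lerDl.
rewrite ler_ln ?posrE; [lra| |by rewrite mulr_gt0 ?ltr0n].
by rewrite ltr_wpDr.
Qed.

Lemma hdist_frame_len g h : frame_det g != 0 -> frame_det h != 0 ->
  0 <= hdist (frame_point g) (frame_point h) <= frame_len g h.
Proof.
move=> g0 h0; rewrite hdist_frame_point //.
have dg : 0 < cabs (frame_det g) by rewrite cabs_gt0.
have dh : 0 < cabs (frame_det h) by rewrite cabs_gt0.
set t := frame_cross g h / _.
have -> : frame_len g h = ln (2 * t).
  by rewrite /frame_len /t; congr ln; field; rewrite !gt_eqF.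
apply: arcosh_bounds; rewrite /t ler_pdivlMr ?mul1r ?frame_cross_ge_det //.
by rewrite !mulr_gt0 ?ltr0n.
Qed.

(** Cholesky decomposition of [herm x]. *)
Lemma frame_point_exists (x : 'rV[R]_3) : H3 x -> exists2 g, frame_det g != 0 & x = frame_point g.
Proof.
rewrite /H3 /= dotE => x1.
pose a := x 0 0; pose b := x 0 1; pose c := x 0 2%:R.
have c1 : 0 < 1 + c.
  rewrite -/a -/b -/c in x1; nra.
have d1 : 0 < 1 - (a * a + b * b + c * c) by rewrite subr_gt0.
pose s := Num.sqrt (1 + c); have s0 : 0 < s by rewrite sqrtr_gt0.
have s2 : s ^+ 2 = 1 + c by rewrite sqr_sqrtr // ltW.
pose r := Num.sqrt (1 - (a * a + b * b + c * c)); have r0 : 0 < r by rewrite sqrtr_gt0.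
have r2 : r ^+ 2 = 1 - (a * a + b * b + c * c) by rewrite sqr_sqrtr // ltW.
(* the columns of a lower triangular square root of [herm x] *)
pose g1 : vec := \col_i if i == 0 then s%:C else Complex (a / s) (- b / s).
pose g2 : vec := \col_i if i == 0 then 0 else (r / s)%:C.
have [g10 g11 g20 g21] : [/\ g1 0 0 = s%:C, g1 1 0 = Complex (a / s) (- b / s),
   g2 0 0 = 0 & g2 1 0 = (r / s)%:C] by rewrite !mxE.
have [sn rn] : s != 0 /\ r != 0 by rewrite !gt_eqF.
exists (g1, g2).
  rewrite /frame_det /cdet /= g10 g11 g20 g21 mulr0 subr0 -rmorphM /=.
  by rewrite mulrCA divff // mulr1 -[0](rmorph0 (real_complex R)) (inj_eq (@complexI R)).
have cc : cabs (g1 1 0) ^+ 2 = (a * a + b * b) / s ^+ 2.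
  by rewrite g11 cabs_sqr /=; field.
have n0 : cabs 0 = 0 by apply/eqP; rewrite cabs0P.
have tr : frame_trace (g1, g2) = 2.
  rewrite /frame_trace /= cc g10 g20 g21 n0 !cabs_real !real_normK ?num_real //.
  rewrite expr0n /= exprMn exprVn r2 s2; field; rewrite gt_eqF //.
have [] := frame_pointE (g1, g2); rewrite frame_herm01 tr /= cc g10 g11 g20 g21 n0 !cabs_real /=.
move: (frame_point _) => y y0 y1 y2; apply/rowP => k.
have kE : [\/ k = 0, k = 1 | k = 2%:R].
  by case: k => [[|[|[|//]]] Hk]; [apply: Or31|apply: Or32|apply: Or33]; apply: val_inj.
have cE : c = s ^+ 2 - 1 by rewrite s2 addrC addKr.
case: kE => ->.
- by rewrite y0 -/a; field.
- by rewrite y1 -/b; field.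
- rewrite y2 -/c !real_normK ?num_real // exprMn exprVn r2.
  by rewrite cE; field.
Qed.

End Frames.

Section IdealFrames.
Variable R : realType.
Local Notation C := R[i].
Local Notation vec := 'cV[C]_2.
Local Notation frame := (vec * vec)%type.

(** The frame representation turns the displacement of a point by [A] into
    [frame_len g (A g)]; Cholesky decomposition provides frames for all the points,
    which is what nonnegativity of the infimum requires. *)
Lemma translation_length_bounds (A : 'M[C]_2) (g : frame) : \det A = 1 -> frame_det g != 0 ->
  0 <= translation_length A <= frame_len g (frame_act A g).
Proof.
move=> A1 g0.
have pos x : H3 x -> 0 <= hdist x (psl_act A x).
  move=> /frame_point_exists[h h0 ->]; rewrite psl_act_frame_point; last by rewrite gt_eqF //
    frame_trace_gt0.
  by have /andP[] := @hdist_frame_len R h (frame_act A h) h0 (eq_ind_r (fun z =>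
    z != 0) h0 (frame_det_act h A1)).
have lb : has_lbound [set hdist x (psl_act A x) | x in @H3 R].
  by exists 0 => _ [x Hx <-]; exact: pos.
apply/andP; split.
  apply: lb_le_inf; first by exists (hdist (frame_point g) (psl_act A (frame_point g))), (frame_point g); first exact: frame_point_H3.
  by move=> _ [x Hx <-]; exact: pos.
apply: (@le_trans _ _ (hdist (frame_point g) (psl_act A (frame_point g)))).
  by apply: ge_inf => //; exists (frame_point g) => //; exact: frame_point_H3.
rewrite psl_act_frame_point; last by rewrite gt_eqF // frame_trace_gt0.
by have /andP[] := @hdist_frame_len R g (frame_act A g) g0 (eq_ind_r (fun z =>
  z != 0) g0 (frame_det_act g A1)).
Qed.

Lemma ideal_point_frame_point (w : vec) : ideal_point w = frame_point (w, 0).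
Proof. by rewrite /ideal_point /frame_point /frame_herm /= mul0mx addr0. Qed.

Lemma vec_eq0 (w : vec) : w 0 0 = 0 -> w 1 0 = 0 -> w = 0.
Proof.
move=> w0 w1; apply/colP => i; rewrite !mxE.
have [->|->] // : i = 0 \/ i = 1.
by case: i => [[|[|//]] Hi]; [left|right]; apply: val_inj.
Qed.

Lemma frame_trace_vec (w : vec) : w != 0 -> frame_trace (w, 0) != 0.
Proof.
apply: contra => /eqP t0.
have n0 : cabs (0 : C) = 0 by apply/eqP; rewrite cabs0P.
move/eqP: t0; rewrite /frame_trace /= !mxE n0 expr0n /= !addr0.
rewrite paddr_eq0 ?sqr_ge0 // !expf_eq0 /= !cabs0P => /andP[/eqP w0 /eqP w1].
by apply/eqP; exact: vec_eq0.
Qed.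

(** For ideal points x and y, 1 - x.y is a multiple of the square of the determinant of the
    two vectors, and it vanishes for x = y. *)
Lemma ideal_point_inj (w w' : vec) : w != 0 -> w' != 0 -> ideal_point w = ideal_point w' ->
  exists2 k, k != 0 & w' = k *: w.
Proof.
move=> w0 w'0; rewrite !ideal_point_frame_point => ww'.
have t0 := frame_trace_vec w0; have t'0 := frame_trace_vec w'0.
have n0 : cabs (0 : C) = 0 by apply/eqP; rewrite cabs0P.
have v0 (v : vec) : cdet 0 v = 0 by rewrite /cdet !mxE !mul0r subr0.
have c0 (v : vec) : cdet v 0 = 0 by rewrite cdetC v0 oppr0.
have d0 : cdet w w' = 0.
  have := dot_frame_point t0 t'0;
    rewrite ww' (dot_frame_point t'0 t'0) /frame_cross /= !v0 !c0 cdetvv n0.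
  rewrite expr0n /= !addr0 mulr0 mul0r => /esym/eqP.
  rewrite mulf_eq0 invr_eq0 !mulf_eq0 (negPf t0) (negPf t'0) orbF pnatr_eq0 /=.
  by rewrite orbb cabs0P orbF ?eqb_id => /eqP.
have [e|w00] := eqVneq (w 0 0) 0.
  have w10 : w 1 0 != 0 by apply: contra w0 => /eqP w10; apply/eqP; exact: vec_eq0.
  have e' : w' 0 0 = 0.
    move/eqP: d0; rewrite /cdet e mul0r sub0r oppr_eq0 mulf_eq0 (negPf w10) /=.
    by move/eqP.
  exists (w' 1 0 / w 1 0).
    rewrite mulf_neq0 ?invr_eq0 //; apply: contra w'0 => /eqP w'1.
    by apply/eqP; exact: vec_eq0.
  apply/eqP; rewrite -subr_eq0; apply/eqP; apply: vec_eq0; rewrite !mxE.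
    by rewrite e e' mulr0 subr0.
  by rewrite divfK // subrr.
have w'E : w' = (w' 0 0 / w 0 0) *: w.
  apply/eqP; rewrite -subr_eq0; apply/eqP; apply: vec_eq0; rewrite !mxE.
    by rewrite divfK // subrr.
  apply: (mulfI w00); rewrite mulr0 -d0 /cdet; field; exact: w00.
exists (w' 0 0 / w 0 0) => //.
by apply: contra w'0 => /eqP k0; rewrite w'E k0 scale0r.
Qed.

Lemma psl_act_ideal_point (A : 'M[C]_2) (w : vec) : w != 0 ->
  psl_act A (ideal_point w) = ideal_point (A *m w).
Proof.
by move=> w0; rewrite !ideal_point_frame_point psl_act_frame_point ?frame_trace_vec //
  /frame_act /= mulmx0.
Qed.

(** The coefficients det(b, c) and det(a, c) make the frame projectively invariant:
    for [r = 0] the frame is a matrix that takes infinity, 0 and -1 to the classes of a,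
    b and c. *)
Definition tripod_frame (a b c : vec) (r : R) : frame :=
  (((expR (r / 2))%:C * cdet b c) *: a, ((expR (- (r / 2)))%:C * cdet a c) *: b).

Lemma frame_det_tripod_frame a b c r : frame_det (tripod_frame a b c r) = cdet b c * cdet a c *
  cdet a b.
Proof.
rewrite /frame_det /tripod_frame /= cdetZl cdetZr.
have e1 : (expR (r / 2))%:C * (expR (- (r / 2)))%:C = 1 :> C.
  by rewrite -rmorphM /= -expRD subrr expR0.
rewrite -[RHS]mul1r -e1; ring.
Qed.

Lemma tripod_frame_scale a b c (k l m : C) r : tripod_frame (k *: a) (l *: b) (m *: c) r =
  ((k * l * m) *: (tripod_frame a b c r).1, (k * l * m) *: (tripod_frame a b c r).2).
Proof.
rewrite /tripod_frame /= !cdetZl !cdetZr !scalerA.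
by congr (_ *: _, _ *: _); ring.
Qed.

Lemma tripod_frame_act A a b c r : \det A = 1 ->
  tripod_frame (A *m a) (A *m b) (A *m c) r = frame_act A (tripod_frame a b c r).
Proof. by move=> A1; rewrite /tripod_frame /frame_act /= !cdet_mul A1 !mul1r -!scalemxAr. Qed.

Definition log_cabs (z : C) : R := ln (cabs z).

Lemma log_cabsM x y : x != 0 -> y != 0 -> log_cabs (x * y) = log_cabs x + log_cabs y.
Proof. by move=> x0 y0; rewrite /log_cabs cabsM lnM // posrE cabs_gt0. Qed.

Lemma log_cabs_exp (r : R) : log_cabs (expR r)%:C = r.
Proof. by rewrite /log_cabs cabs_real ger0_norm ?expR_ge0 // expRK. Qed.

Lemma exp_neq0 (r : R) : (expR r)%:C != 0 :> C.
Proof. by rewrite -cabs0P cabs_real normr_eq0 gt_eqF // expR_gt0. Qed.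

(** The constant comes from log 4 <= 3, the frame length being the logarithm of a
    sum of four terms. *)
Lemma frame_len_le (g h : frame) (m : R) : frame_det g != 0 -> frame_det h != 0 ->
  (forall a b, a \in [:: g.1; g.2] -> b \in [:: h.1; h.2] -> cdet a b != 0 ->
    2 * log_cabs (cdet a b) <= m + log_cabs (frame_det g) + log_cabs (frame_det h)) ->
  frame_len g h <= m + 3.
Proof.
move=> g0 h0 le.
have dg : 0 < cabs (frame_det g) by rewrite cabs_gt0.
have dh : 0 < cabs (frame_det h) by rewrite cabs_gt0.
have le' a b : a \in [:: g.1; g.2] -> b \in [:: h.1; h.2] ->
    cabs (cdet a b) ^+ 2 <= expR m * (cabs (frame_det g) * cabs (frame_det h)).
  move=> ag bh; have [->|ab0] := eqVneq (cdet a b) 0.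
    by rewrite cabsE /= expr0n /= addr0 sqrtr0 expr0n /= !mulr_ge0 ?expR_ge0 // ltW.
  have ab : 0 < cabs (cdet a b) by rewrite cabs_gt0.
  rewrite -ler_ln ?posrE ?exprn_gt0 ?mulr_gt0 ?expR_gt0 //.
  rewrite !lnM ?posrE ?mulr_gt0 ?expR_gt0 // expRK addrA.
  by apply: le_trans (le a b ag bh ab0); rewrite mulr_natl mulr2n.
rewrite /frame_len -[leRHS]expRK ler_ln ?posrE ?expR_gt0 ?divr_gt0 ?mulr_gt0 ?frame_cross_gt0 //.
rewrite ler_pdivrMr ?mulr_gt0 // expRD.
apply: (@le_trans _ _ (4 * (expR m * (cabs (frame_det g) * cabs (frame_det h))))).
  have := le' g.1 h.1; have := le' g.1 h.2; have := le' g.2 h.1; have := le' g.2 h.2.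
  rewrite !inE !eqxx !orbT => /(_ isT isT) h1 /(_ isT isT) h2 /(_ isT isT) h3 /(_ isT isT) h4.
  by rewrite /frame_cross; lra.
rewrite mulrCA -[leRHS]mulrA ler_pM2l ?expR_gt0 // ler_pM2r ?mulr_gt0 //.
by apply: le_trans (expR_ge1Dx 3); lra.
Qed.

End IdealFrames.

(** * Dual spines and their Busemann functions *)

Section Spine.
Variables (R : realType) (n : nat) (N : 'M[R]_(n, 3)) (j : 'I_n).

Local Notation pos := (ray_pos N j).
Definition end_dist (v w : 'I_4) : R := `|pos v - pos w|.
Local Notation dl := end_dist.

(** Busemann function of the end [v] of the spine, normalised to vanish where its ray
    is attached. *)
Definition busemann (v : 'I_4) (q : spine_pt R) : R :=
  match q with
  | Seg x => `|x - pos v|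
  | Ray w r => if v == w then - r else r + dl v w
  end.

Lemma end_distC v w : dl v w = dl w v.
Proof. exact: distrC. Qed.

Lemma end_dist_triangle u v w : dl u w <= dl u v + dl v w.
Proof. exact: ler_distD. Qed.

Lemma end_dist_ge0 v w : 0 <= dl v w.
Proof. exact: normr_ge0. Qed.

Lemma end_dist_xx v : dl v v = 0.
Proof. by rewrite /end_dist subrr normr0. Qed.

Lemma busemann_lipschitz v q q' : in_spine N j q -> in_spine N j q' ->
  busemann v q <= busemann v q' + spine_len N j q q'.
Proof.
have tri (a b c : R) : `|a - c| <= `|a - b| + `|b - c| := ler_distD b a c.
case: q => [x|w r]; case: q' => [y|w' s] /= hq hq'.
- by rewrite [leRHS]addrC; exact: tri.
- case: eqVneq => [->|vw].
    by rewrite addrCA addNr addr0.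
  by have := tri x (pos w') (pos v); rewrite /end_dist (distrC (pos v)); lra.
- have := normr_ge0 (y - pos w); have := normr_ge0 (y - pos v).
  case: eqVneq => [->|vw]; first by lra.
  by have := tri (pos v) y (pos w); rewrite /end_dist (distrC (pos v) y); lra.
- have := end_dist_ge0 w w'; rewrite -/(end_dist w w').
  have [ww'|ww'] := eqVneq w w'.
    subst w'; have := ler_norm (r - s); have := ler_norm (- (r - s)); rewrite normrN.
    by case: eqVneq => _; rewrite /= ?end_dist_xx; lra.
  have [vw|vw] := eqVneq v w; have [vw'|vw'] := eqVneq v w'.
  + by rewrite -vw vw' eqxx in ww'.
  + by subst v; lra.
  + by subst v; rewrite (end_distC w' w); lra.
  + by have := end_dist_triangle v w' w; rewrite (end_distC w' w); lra.
Qed.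

(** The value delta(v, w) is attained on the line joining the two ends. *)
Lemma busemann_ge v w q : v != w -> in_spine N j q ->
  dl v w <= busemann v q + busemann w q.
Proof.
move=> vw; case: q => [x _|k r] /=.
  by have := ler_distD x (pos v) (pos w); rewrite /end_dist (distrC (pos v) x).
move=> r0; have [vk|vk] := eqVneq v k; have [wk|wk] := eqVneq w k.
- by rewrite vk wk eqxx in vw.
- by rewrite vk (end_distC w); lra.
- by rewrite wk; lra.
- by have := end_dist_triangle v k w; rewrite (end_distC w); lra.
Qed.

(** Distance from the attaching point of the ray of [x] to the centre of the tripod
    of [x], [y], [c]. *)
Definition gromov (x y c : 'I_4) : R := (dl x y + dl x c - dl y c) / 2.

(** The point [q] lies on the line from the end [y] to the end [x] of the spine, at signed
    distance [r] towards [x] from the branching point of the ray to [c]. A point of a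
    spine has several presentations, and a frame is attached to each. *)
Definition presents (q : spine_pt R) (x y c : 'I_4) (r : R) : Prop :=
  [/\ x != y, x != c, y != c, busemann x q = gromov x y c - r &
      busemann y q = gromov y x c + r].

Variables (X : R) (k : 'I_4).
Hypothesis X0 : 0 <= X.
Hypothesis k0 : k != 0.
Hypothesis qmax : quad_max N j = X.
Hypothesis posE : forall v, pos v = if (v == 0) || (v == k) then 0 else X.

Lemma pos_cases v : pos v = 0 \/ pos v = X.
Proof. by rewrite posE; case: ifP => _; [left|right]. Qed.

(** Two of the four rays are attached at each endpoint. *)
Lemma pos_sum a b c d : uniq [:: a; b; c; d] -> pos a + pos b + pos c + pos d = 2 * X.
Proof.
move=> u; rewrite !posE.
have kE : [\/ k = 1, k = 2%:R | k = 3%:R].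
  by case: (k) k0 => [[|[|[|[|//]]]] Hk] // _; [apply: Or31|apply: Or32|apply: Or33];
    apply: val_inj.
case: kE => ->.
all: case: a u => [[|[|[|[|//]]]] ?]; case: b => [[|[|[|[|//]]]] ?] //;
  case: c => [[|[|[|[|//]]]] ?] //; case: d => [[|[|[|[|//]]]] ?] // _.
all: rewrite -!val_eqE /=.
all: by ring.
Qed.

Lemma tripod_centreE f : tripod_centre N j f = X - pos f.
Proof.
rewrite /tripod_centre qmax; have [->|->] := pos_cases f; first by rewrite eqxx subr0.
by rewrite subrr; case: eqP => // ->.
Qed.

(** The centre of the tripod is the median of the three attaching points, hence equal to
    at least two of them. *)
Lemma tripod_median f w b c : uniq [:: w; b; c; f] ->
  pos w = tripod_centre N j f \/ pos b = tripod_centre N j f /\ pos c = tripod_centre N j f.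
Proof.
move=> /pos_sum; rewrite tripod_centreE.
have [->|->] := pos_cases w; have [->|->] := pos_cases b;
  have [->|->] := pos_cases c; have [->|->] := pos_cases f => s;
  by [left; lra|right; split; lra].
Qed.

Lemma tripod_presents (f w b c : 'I_4) (r : R) : uniq [:: w; b; c; f] -> 0 <= r ->
  presents (tripod_pt N j f w r) w b c r.
Proof.
move=> u r0; have u' : uniq [:: b; w; c; f].
  by rewrite (@perm_uniq _ _ [:: w; b; c; f]) // (perm_catCA [:: b] [:: w]).
have := tripod_median u; have := tripod_median u'.
have m0X : tripod_centre N j f = 0 \/ tripod_centre N j f = X.
  by rewrite tripod_centreE; have [->|->] := pos_cases f; [right|left]; lra.
move: u; rewrite /= !inE !negb_or => /andP[/and3P[wb wc wf] /andP[/andP[bc bf] _]].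
have bw : (b == w) = false by rewrite eq_sym (negPf wb).
rewrite /presents /tripod_pt; move: (tripod_centre N j f) m0X => m m0X mb mw.
suff [? ?] : busemann w (if r <= `|m - pos w| then Seg `|m - r| else Ray w (r - `|m - pos w|))
      = gromov w b c - r /\
    busemann b (if r <= `|m - pos w| then Seg `|m - r| else Ray w (r - `|m - pos w|))
      = gromov b w c + r by split.
rewrite /gromov /end_dist.
case: mw => [pw|[pb pc]].
- have [-> ->] : `|pos w - pos b| = `|m - pos b| /\ `|pos w - pos c| = `|m - pos c|.
    by rewrite pw.
  have -> : `|pos b - pos w| = `|m - pos b| by rewrite pw distrC.
  have bcE : `|pos b - pos c| = `|m - pos b| + `|m - pos c|.
    case: mb => [->|[_ ->]]; first by rewrite subrr normr0 add0r.
    by rewrite subrr normr0 addr0 distrC.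
  rewrite bcE pw subrr normr0; case: ifP => [r0'|_].
    have -> : r = 0 by lra.
    rewrite /= subr0 pw.
    have -> : `|m| = m by case: m0X => ->; rewrite ?normr0 // ger0_norm.
    by rewrite subrr normr0; split; lra.
  by rewrite /= eqxx bw subr0 /end_dist pw (distrC (pos b)); split; lra.
- rewrite pb pc subrr normr0 (distrC (pos w)).
  case: ifP => [|_]; last first.
    by rewrite /= eqxx bw /end_dist pb; split; lra.
  rewrite /= pb.
  have [pw|pw] := pos_cases w; case: m0X => ->; rewrite pw.
  all: rewrite ?subrr ?subr0 ?sub0r ?normrN ?normr0 ?(ger0_norm X0) ?(ger0_norm r0) => rX.
  + have -> : r = 0 by lra.
    by rewrite ?normr0; split; lra.
  + have Xr : `|X - r| = X - r by rewrite ger0_norm // subr_ge0.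
    have -> : `|X - r| - X = - r by rewrite Xr; lra.
    by rewrite normr_id Xr normrN (ger0_norm r0); split; lra.
  + by rewrite distrC ger0_norm ?subr_ge0 //; split; lra.
  + have -> : r = 0 by lra.
    by rewrite subr0 (ger0_norm X0) subrr normr0; split; lra.
Qed.

Lemma ord4_other (x y : 'I_4) : exists c, (c != x) && (c != y).
Proof.
have : (0 < #|~: [set x; y]|)%N.
  rewrite cardsCs finset.setCK card_ord subn_gt0 (@leq_ltn_trans 2) //.
  by rewrite cards2; case: eqP.
by case/card_gt0P => c; rewrite !inE negb_or; exists c.
Qed.

Lemma presents_exists q : in_spine N j q -> exists x y c r, presents q x y c r.
Proof.
have line x y : x != y -> busemann x q + busemann y q = dl x y ->
    exists x y c r, presents q x y c r.
  move=> xy e; have [c /andP[cx cy]] := ord4_other x y.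
  exists x, y, c, (gromov x y c - busemann x q); split => //; rewrite 1?eq_sym //; first by lra.
  by move: e; rewrite /gromov (end_distC y x); lra.
case: q line => [t|v r] line /= hq.
- (* an interval point lies on a line between ends attached at different endpoints *)
  have k1 : 0 != k by rewrite eq_sym.
  have [y [y0 yk]] : exists y, y != 0 /\ y != k.
    by have [y /andP[? ?]] := ord4_other 0 k; exists y.
  apply: (line 0 y); first by rewrite eq_sym.
  rewrite /= /end_dist !posE eqxx /= (negPf y0) (negPf yk) /= !sub0r normrN subr0.
  move: hq; rewrite qmax => /andP[t0 tX].
  by rewrite (ger0_norm t0) (ger0_norm X0) distrC ger0_norm ?subr_ge0 //; lra.
- have [y /andP[yv _]] := ord4_other v v.
  apply: (line v y); first by rewrite eq_sym.
  by rewrite /= eqxx (negPf yv) (end_distC y); lra.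
Qed.

End Spine.

Section Tropical.
Variables (R : realType) (n : nat) (xi : 'M[R]_(n, 3)) (j : 'I_n).

(** The shape of the coordinate triples of points of the ideal boundary of the
    deformation variety. *)
Definition tropical : Prop :=
  [\/ [/\ xi j 0 = 0, 0 <= xi j 1 & xi j 2%:R = - xi j 1],
      [/\ xi j 1 = 0, 0 <= xi j 2%:R & xi j 0 = - xi j 2%:R] |
      [/\ xi j 2%:R = 0, 0 <= xi j 0 & xi j 1 = - xi j 0]].

Local Notation N := (quad_coords xi).

Lemma edge_label0 (v : 'I_4) : v != 0 ->
  edge_label [set 0; v]%SET = if v == 1 then 0 else if v == 2%:R then 1 else 2%:R.
Proof.
have ne (a b c d x : 'I_4) : x \in [set a; b]%SET -> x \notin [set c; d]%SET ->
    ([set a; b]%SET == [set c; d]%SET) = false.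
  by move=> xa; apply: contraNF => /eqP <-.
move=> v0; rewrite /edge_label.
have [->|v1] := eqVneq v 1; first by rewrite eqxx.
rewrite (ne _ _ 0 1 v) ?inE ?eqxx ?orbT ?negb_or ?v0 ?v1 //.
rewrite (ne _ _ 2%:R 3%:R 0) ?inE ?eqxx //.
have [->|v2] := eqVneq v 2%:R; first by rewrite eqxx.
rewrite (ne _ _ 0 2%:R v) ?inE ?eqxx ?orbT ?negb_or ?v0 ?v2 //.
by rewrite (ne _ _ 1 3%:R 0) ?inE ?eqxx.
Qed.

Lemma ray_pos_pairing (N : 'M[R]_(n, 3)) (X : R) (e : 'I_3) (k : 'I_4) : 0 <= X ->
  (forall e', N j e' = if e' == e then X else 0) ->
  (forall v, v != 0 -> (edge_label [set 0; v]%SET == e) = (v == k)) ->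
  quad_max N j = X /\ forall v, ray_pos N j v = if (v == 0) || (v == k) then 0 else X.
Proof.
move=> X0 NE ek.
have qX : quad_max N j = X.
  rewrite /quad_max !NE.
  have eE : [\/ e = 0, e = 1 | e = 2%:R].
    by case: (e) => [[|[|[|//]]] He]; [apply: Or31|apply: Or32|apply: Or33]; apply: val_inj.
  by case: eE => -> /=; rewrite ?maxxx ?(max_l X0) ?(max_r X0).
split => // v; rewrite /ray_pos /same_side qX NE [0 == v]eq_sym.
have [//|v0] := eqVneq v 0; rewrite /= ek //; case: (v == k); first by rewrite eqxx.
by case: eqP.
Qed.

(** The quadrilateral with the largest coordinate pairs vertex 0 with a vertex [k], and the
    coordinates of [xi] are recovered from the distances between attaching points as
    the degenerations of the cross ratios. *)
Lemma tropical_shape : tropical -> exists (X : R) (k : 'I_4),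
  [/\ 0 <= X, k != 0, quad_max N j = X,
      forall v, ray_pos N j v = if (v == 0) || (v == k) then 0 else X &
      end_dist N j 0 2%:R + end_dist N j 1 3%:R - end_dist N j 0 3%:R - end_dist N j 1 2%:R
        = 2 * xi j 0 /\
      end_dist N j 0 3%:R + end_dist N j 1 2%:R - end_dist N j 0 1 - end_dist N j 2%:R 3%:R
        = 2 * xi j 1].
Proof.
have NE : [/\ N j 0 = if (xi j 0 == 0) && (0 <= xi j 1) then xi j 1 else 0,
    N j 1 = if (xi j 1 == 0) && (0 <= xi j 2%:R) then xi j 2%:R else 0 &
    N j 2%:R = if (xi j 2%:R == 0) && (0 <= xi j 0) then xi j 0 else 0].
  have e01 : (0 + 1 : 'I_3) = 1 by apply: val_inj.
  have e12 : (1 + 1 : 'I_3) = 2%:R by apply: val_inj.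
  have e20 : (2%:R + 1 : 'I_3) = 0 by apply: val_inj.
  by rewrite !mxE e01 e12 e20.
have ifN0 (x : R) b : (- x == 0) && b -> - x = 0 by case/andP => /eqP.
have ord3 (e : 'I_3) : [\/ e = 0, e = 1 | e = 2%:R].
  by case: e => [[|[|[|//]]] He]; [apply: Or31|apply: Or32|apply: Or33]; apply: val_inj.
have ord4 (v : 'I_4) : [\/ v = 0, v = 1, v = 2%:R | v = 3%:R].
  by case: v => [[|[|[|[|//]]]] Hv]; [apply: Or41|apply: Or42|apply: Or43|apply: Or44];
    apply: val_inj.
have shape (X : R) (e : 'I_3) (k : 'I_4) : 0 <= X -> k != 0 ->
    (forall e', N j e' = if e' == e then X else 0) ->
    (forall v, v != 0 -> (edge_label [set 0; v]%SET == e) = (v == k)) ->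
    (forall p : 'I_4 -> R, (forall v, p v = if (v == 0) || (v == k) then 0 else X) ->
      `|p 0 - p 2%:R| + `|p 1 - p 3%:R| - `|p 0 - p 3%:R| - `|p 1 - p 2%:R| = 2 * xi j 0 /\
      `|p 0 - p 3%:R| + `|p 1 - p 2%:R| - `|p 0 - p 1| - `|p 2%:R - p 3%:R| = 2 * xi j 1) ->
    exists (X : R) (k : 'I_4),
  [/\ 0 <= X, k != 0, quad_max N j = X,
      forall v, ray_pos N j v = if (v == 0) || (v == k) then 0 else X &
      end_dist N j 0 2%:R + end_dist N j 1 3%:R - end_dist N j 0 3%:R - end_dist N j 1 2%:R
        = 2 * xi j 0 /\
      end_dist N j 0 3%:R + end_dist N j 1 2%:R - end_dist N j 0 1 - end_dist N j 2%:R 3%:R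
        = 2 * xi j 1].
  move=> X0 k0 NX ek dist; have [q p] := ray_pos_pairing X0 NX ek.
  by exists X, k; split => //; exact: dist.
case: NE => N0 N1 N2 [[x0 x1 x2]|[x1 x2 x0]|[x2 x0 x1]].
- rewrite x0 eqxx x1 /= in N0.
  apply: (shape (xi j 1) 0 1) => //.
  + move=> e'; case: (ord3 e') => -> //=; first rewrite N1; last rewrite N2.
    - by case: ifP => // /andP[_]; rewrite x2; lra.
    - by rewrite x0; case: ifP.
  + by move=> v v0; rewrite edge_label0 //; case: (ord4 v) => ->.
  + by move=> p pE; rewrite !pE /= ?subrr ?sub0r ?subr0 ?normrN ?normr0 ?(ger0_norm x1); split; lra.
- rewrite x1 eqxx x2 /= in N1.
  apply: (shape (xi j 2%:R) 1 2%:R) => //.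
  + move=> e'; case: (ord3 e') => -> //=; first rewrite N0; last rewrite N2.
    - by rewrite x1; case: ifP.
    - by case: ifP => // /andP[_]; rewrite x0; lra.
  + by move=> v v0; rewrite edge_label0 //; case: (ord4 v) => ->.
  + by move=> p pE; rewrite !pE /= ?subrr ?sub0r ?subr0 ?normrN ?normr0 ?(ger0_norm x2); split; lra.
- rewrite x2 eqxx x0 /= in N2.
  apply: (shape (xi j 0) 2%:R 3%:R) => //.
  + move=> e'; case: (ord3 e') => -> //=; first rewrite N0; last rewrite N1.
    - by case: ifP => // /andP[_]; rewrite x1; lra.
    - by rewrite x2; case: ifP.
  + by move=> v v0; rewrite edge_label0 //; move: v0; case: (ord4 v) => ->.
  + by move=> p pE; rewrite !pE /= ?subrr ?sub0r ?subr0 ?normrN ?normr0 ?(ger0_norm x0); split; lra.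
Qed.

End Tropical.

(** * Distances in one degenerating tetrahedron *)

Section TetBound.
Variable R : realType.
Local Notation vec := 'cV[R[i]]_2.

Lemma ord4P (v : 'I_4) : [\/ v = 0, v = 1, v = 2%:R | v = 3%:R].
Proof.
by case: v => [[|[|[|[|//]]]] Hv]; [apply: Or41|apply: Or42|apply: Or43|apply: Or44];
  apply: val_inj.
Qed.

(** Six numbers attached to the pairs of vertices are determined, up to adding constants
    attached to the vertices, by the differences of the three sums over opposite edges,
    here the logarithms of two cross ratios. Solving for the constants on the edges 01,
    02, 12 and 03 leaves an error on the other two edges only. *)
Lemma four_point_normalisation (L d : 'I_4 -> 'I_4 -> R) (e : R) :
  (forall v w, L v w = L w v) -> (forall v w, d v w = d w v) ->
  `|(L 0 2%:R + L 1 3%:R - L 0 3%:R - L 1 2%:R) -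
    (d 0 2%:R + d 1 3%:R - d 0 3%:R - d 1 2%:R)| <= e ->
  `|(L 0 3%:R + L 1 2%:R - L 0 1 - L 2%:R 3%:R) -
    (d 0 3%:R + d 1 2%:R - d 0 1 - d 2%:R 3%:R)| <= e ->
  exists c, forall v w, v != w -> `|L v w - c v - c w - d v w| <= e.
Proof.
move=> LC dC; pose m v w := L v w - d v w.
pose c0 := (m 0 1 + m 0 2%:R - m 1 2%:R) / 2.
pose c1 := m 0 1 - c0; pose c2 := m 0 2%:R - c0; pose c3 := m 0 3%:R - c0.
rewrite !ler_norml => /andP[h1 h2] /andP[h3 h4].
exists (fun v => if v == 0 then c0 else if v == 1 then c1 else if v == 2%:R then c2 else c3).
move=> v w; rewrite ler_norml /c3 /c2 /c1 /c0 /m.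
case: (ord4P v) => ->; case: (ord4P w) => -> //= _; rewrite ?(LC 1 0) ?(dC 1 0)
  ?(LC 2%:R 0) ?(dC 2%:R 0) ?(LC 3%:R 0) ?(dC 3%:R 0) ?(LC 2%:R 1) ?(dC 2%:R 1)
  ?(LC 3%:R 1) ?(dC 3%:R 1) ?(LC 3%:R 2%:R) ?(dC 3%:R 2%:R); apply/andP; split; lra.
Qed.

Variables (n : nat) (N : 'M[R]_(n, 3)) (j : 'I_n).
Variables (w : 'I_4 -> vec) (u e : R) (c : 'I_4 -> R).
Hypothesis u0 : 0 < u.
Hypothesis w_indep : forall v v', v != v' -> cdet (w v) (w v') != 0.
Hypothesis wc : forall v v', v != v' ->
  `|u * (2 * log_cabs (cdet (w v) (w v'))) - c v - c v' - end_dist N j v v'| <= e.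

(** Each vector of the frame is a multiple [K] of a vertex vector; after rescaling, the
    weight |K|^2 / |det g| is governed by the Busemann function of that vertex at
    [q]. The three determinants involved account for three halves of the error. *)
Lemma tripod_frame_weight q x y z r a : presents N j q x y z r ->
  let g := tripod_frame (w x) (w y) (w z) (r / u) in a \in [:: g.1; g.2] ->
  exists v K, [/\ a = K *: w v, K != 0 &
    u * (2 * log_cabs K - log_cabs (frame_det g)) <= - c v - busemann N j v q + 3 / 2 * e].
Proof.
move=> [xy xz yz bx byq] g.
have yz0 : cdet (w y) (w z) != 0 by exact: w_indep.
have xz0 : cdet (w x) (w z) != 0 by exact: w_indep.
have xy0 : cdet (w x) (w y) != 0 by exact: w_indep.
have gE : log_cabs (frame_det g) = log_cabs (cdet (w y) (w z)) + log_cabs (cdet (w x) (w z)) +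
    log_cabs (cdet (w x) (w y)).
  by rewrite /g frame_det_tripod_frame !log_cabsM ?mulf_neq0.
have := wc xy; have := wc xz; have := wc yz; rewrite !ler_norml.
move: gE; rewrite /g; set lyz := log_cabs (cdet (w y) (w z));
  set lxz := log_cabs (cdet (w x) (w z)).
set lxy := log_cabs (cdet (w x) (w y)) => gE /andP[h1 h2] /andP[h3 h4] /andP[h5 h6].
have ru : u * (r / u) = r by rewrite mulrCA divff ?mulr1 // gt_eqF.
rewrite !inE => /orP[|] /eqP ->.
- exists x, ((expR (r / u / 2))%:C * cdet (w y) (w z)); split => //.
    by rewrite mulf_neq0 // exp_neq0.
  rewrite gE log_cabsM ?exp_neq0 // log_cabs_exp bx /gromov -/lyz.
  have -> : u * (2 * (r / u / 2 + lyz) - (lyz + lxz + lxy)) =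
    u * (r / u) + (u * (2 * lyz) - u * (2 * lxz) - u * (2 * lxy)) / 2 by field; rewrite gt_eqF.
  by rewrite ru; lra.
- exists y, ((expR (- (r / u / 2)))%:C * cdet (w x) (w z)); split => //.
    by rewrite mulf_neq0 // exp_neq0.
  rewrite gE log_cabsM ?exp_neq0 // log_cabs_exp byq /gromov (end_distC N j y x) -/lxz.
  have -> : u * (2 * (- (r / u / 2) + lxz) - (lyz + lxz + lxy)) =
    - (u * (r / u)) + (u * (2 * lxz) - u * (2 * lyz) - u * (2 * lxy)) / 2 by field; rewrite gt_eqF.
  by rewrite ru; lra.
Qed.

(** With the weights of the two frames, the term of the vertices [v] and [v'] becomes
    delta(v, v') - b_v(q) - b_v'(q'), at most b_v'(q) - b_v'(q') by [busemann_ge], which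
    is bounded because Busemann functions are 1-Lipschitz. *)
Lemma frame_len_presents q q' x y z r x' y' z' r' :
  in_spine N j q -> in_spine N j q' ->
  presents N j q x y z r -> presents N j q' x' y' z' r' ->
  u * frame_len (tripod_frame (w x) (w y) (w z) (r / u)) (tripod_frame (w x') (w y') (w z') (r' / u)) <=
    spine_len N j q q' + 4 * e + 3 * u.
Proof.
move=> iq iq' pq pq'.
have fd x1 y1 z1 r1 q1 : presents N j q1 x1 y1 z1 r1 ->
    frame_det (tripod_frame (w x1) (w y1) (w z1) (r1 / u)) != 0.
  by move=> [? ? ? _ _]; rewrite frame_det_tripod_frame !mulf_neq0 // w_indep.
have g0 := fd _ _ _ _ _ pq; have h0 := fd _ _ _ _ _ pq'.
have := @frame_len_le R _ _ ((spine_len N j q q' + 4 * e) / u) g0 h0.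
move=> /(_ _)/wrap[|fl].
  move=> a b ag bh ab0.
  have [v [K [aE K0 Kle]]] := tripod_frame_weight pq ag.
  have [v' [K' [bE K'0 K'le]]] := tripod_frame_weight pq' bh.
  have vv'0 : cdet (w v) (w v') != 0.
    by apply: contra ab0 => /eqP vv'; rewrite aE bE cdetZl cdetZr vv' !mulr0.
  have vv' : v != v' by apply: contra vv'0 => /eqP ->; rewrite cdetvv.
  have := wc vv'; rewrite ler_norml => /andP[_ lvv'].
  have := busemann_ge vv' iq; have := busemann_lipschitz v' iq iq'.
  move: Kle K'le; rewrite aE bE cdetZl cdetZr !log_cabsM ?mulf_neq0 //.
  set lg := log_cabs (frame_det _); set lh := log_cabs (frame_det _) => Kle K'le d1 d2.
  rewrite -(ler_pM2l u0) !(mulrDr u) [u * ((_ + _) / u)]mulrC divfK ?gt_eqF //.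
  have -> : u * (2 * (log_cabs K + (log_cabs K' + log_cabs (cdet (w v) (w v'))))) =
    u * (2 * log_cabs K - lg) + u * (2 * log_cabs K' - lh) + u * (2 *
      log_cabs (cdet (w v) (w v'))) +
    u * lg + u * lh by ring.
  lra.
rewrite -(ler_pM2l u0) mulrDr [u * (_ / u)]mulrC divfK ?gt_eqF // in fl.
by rewrite (mulrC 3).
Qed.

End TetBound.

(** * Distances along chains of spines *)

Section ChainBound.
Variables (R : realType) (n : nat) (T : face_pairing n).
Variables (M : topologicalType) (phi : 'I_n -> ideal_simplex R -> M).
Variables (E : topologicalType) (p : E -> M) (xi : 'M[R]_(n, 3)).
Local Notation vec := 'cV[R[i]]_2.
Local Notation N := (quad_coords xi).
Hypothesis trop : forall j, tropical xi j.

(** One quantity that dominates both the additive constants, after rescaling, and the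
    distance of the rescaled logarithms to their limits. *)
Definition scaling_error (Z : 'M[R[i]]_(n, 3)) : R :=
  scale_u Z + \sum_j \sum_k `|scale_u Z * log_cabs (Z j k) - xi j k|.

(** Vectors of C^2 representing the ideal vertices of the developed tetrahedra. Only their
    lines are determined by the developing map, hence the scalars in the second
    condition; the first one expresses the cross ratios by [Z]. *)
Definition vertex_vectors (Z : 'M[R[i]]_(n, 3)) (W : tet R n E -> 'I_4 -> vec) : Prop :=
  (forall s, is_tet phi p s ->
     let l v w := log_cabs (cdet (W s v) (W s w)) in
     [/\ forall v w, v != w -> cdet (W s v) (W s w) != 0,
       l 0 2%:R + l 1 3%:R - l 0 3%:R - l 1 2%:R = log_cabs (Z s.1 0) &
       l 0 3%:R + l 1 2%:R - l 0 1 - l 2%:R 3%:R = log_cabs (Z s.1 1)]) /\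
  (forall s t f v, share_face T phi p s t f -> v != f ->
     exists2 k, k != 0 & W t (fp_perm T s.1 f v) = k *: W s v).

Definition vertex_frame (W : tet R n E -> 'I_4 -> vec) (u : R) (s : tet R n E)
    (x y z : 'I_4) (r : R) : vec * vec := tripod_frame (W s x) (W s y) (W s z) (r / u).

Lemma scale_u_gt0 (Z : 'M[R[i]]_(n, 3)) : 0 < scale_u Z.
Proof.
rewrite invr_gt0 sqrtr_gt0 ltr_pwDl ?ltr01 //.
by apply: sumr_ge0 => j _; apply: sumr_ge0 => k _; exact: sqr_ge0.
Qed.

Lemma scaling_error_ge Z : 0 <= scaling_error Z /\ scale_u Z <= scaling_error Z.
Proof.
have s0 : 0 <= \sum_j \sum_k `|scale_u Z * log_cabs (Z j k) - xi j k|.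
  by apply: sumr_ge0 => j _; apply: sumr_ge0 => k _.
have u0 := scale_u_gt0 Z.
by rewrite /scaling_error; split; lra.
Qed.

Lemma scaling_error_coord Z j k : `|scale_u Z * log_cabs (Z j k) - xi j k| <= scaling_error Z.
Proof.
rewrite /scaling_error (bigD1 j) //= (bigD1 k) //=.
have u0 := scale_u_gt0 Z.
have s1 : 0 <= \sum_(i | i != k) `|scale_u Z * log_cabs (Z j i) - xi j i| by apply: sumr_ge0.
have s2 : 0 <= \sum_(i | i != j) \sum_k0 `|scale_u Z * log_cabs (Z i k0) - xi i k0|.
  by apply: sumr_ge0 => i _; apply: sumr_ge0.
by lra.
Qed.

Section OneRepresentation.
Variables (Z : 'M[R[i]]_(n, 3)) (W : tet R n E -> 'I_4 -> vec).
Hypothesis vvW : vertex_vectors Z W.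
Local Notation u := (scale_u Z).
Local Notation err := (scaling_error Z).
Local Notation frm := (vertex_frame W u).

Lemma vertex_frame_neq0 s q x y z r : is_tet phi p s -> presents N s.1 q x y z r ->
  frame_det (frm s x y z r) != 0.
Proof.
move=> ts [xy xz yz _ _]; have [/(_ s ts)[h _ _] _] := vvW.
by rewrite frame_det_tripod_frame !mulf_neq0 // h.
Qed.

(** The constant 11 is 4 * 2 + 3: [frame_len_presents] takes 4 times the error of the doubled
    logarithms of determinants, and [frame_len_le] has the additive constant 3. *)
Lemma tet_bound s q q' x y z r x' y' z' r' : is_tet phi p s ->
  in_spine N s.1 q -> in_spine N s.1 q' ->
  presents N s.1 q x y z r -> presents N s.1 q' x' y' z' r' ->
  u * frame_len (frm s x y z r) (frm s x' y' z' r') <= spine_len N s.1 q q' + 11 * err.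
Proof.
move=> ts iq iq' pq pq'.
have [/(_ s ts)[ind l0 l1] _] := vvW.
have [X [k [X0 k0 qX pE [d0 d1]]]] := tropical_shape (trop s.1).
have u0 := scale_u_gt0 Z.
have [e0 ue] := scaling_error_ge Z.
have := scaling_error_coord Z s.1 0; have := scaling_error_coord Z s.1 1.
rewrite -l0 -l1 !ler_norml => /andP[h1 h2] /andP[h3 h4].
have [||||c wc] := @four_point_normalisation R (fun v w => u * (2 *
  log_cabs (cdet (W s v) (W s w))))
    (end_dist N s.1) (2 * err).
- by move=> v w; rewrite cdetC /log_cabs cabsN.
- exact: end_distC.
- by rewrite d0 ler_norml; apply/andP; split; lra.
- by rewrite d1 ler_norml; apply/andP; split; lra.
have := frame_len_presents u0 ind wc iq iq' pq pq'.
by rewrite -/(frm s x y z r); lra.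
Qed.

Lemma spine_len_xx j q : spine_len N j q q = 0.
Proof. by case: q => [x|v r] /=; rewrite ?eqxx subrr normr0. Qed.

Lemma tripod_pt_in_spine (j : 'I_n) (f w : 'I_4) (r : R) : 0 <= r ->
  in_spine N j (tripod_pt N j f w r).
Proof.
move=> r0; have [X [k [X0 k0 qX pE _]]] := tropical_shape (trop j).
rewrite /tripod_pt (tripod_centreE qX pE).
have pf := pos_cases pE f; have pw := pos_cases pE w.
case: ifP => [|/negbT]; rewrite -?ltNge => h; last by rewrite /= subr_ge0 ltW.
rewrite /= normr_ge0 qX /=; move: h.
case: pf => ->; case: pw => ->; rewrite ?(subr0, subrr, sub0r, normrN, normr0, ger0_norm X0) => h;
  rewrite ler_norml; apply/andP; split; lra.
Qed.

Lemma presented s q : is_tet phi p s -> in_spine N s.1 q ->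
  exists x y z r, presents N s.1 q x y z r.
Proof.
move=> ts iq; have [X [k [X0 k0 qX pE _]]] := tropical_shape (trop s.1).
exact: (presents_exists X0 k0 qX pE iq).
Qed.

End OneRepresentation.

Lemma scaled_triangle (u l l1 l2 b1 b2 : R) : 0 < u -> l <= l1 + l2 ->
  u * l1 <= b1 -> u * l2 <= b2 -> u * l <= b1 + b2.
Proof.
move=> u0 ll h1 h2; apply: le_trans (lerD h1 h2).
by rewrite -mulrDr ler_pM2l.
Qed.

Lemma chain_points a b L : spine_chain T phi p N a b L ->
  is_spines_pt phi p N a /\ is_spines_pt phi p N b.
Proof.
elim=> {a b L} [a sa|s q q' b L sq _ _ [_ sb]|a a' b L [f [w [r [[ta _ _ _] _ r0 a2 _]]]] _ [_ sb]].
- by [].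
- by [].
- by split => //; split => //; rewrite a2; exact: tripod_pt_in_spine.
Qed.

(** Across a face, the two tripod points carry proportional frames, so only the arcs
    contribute to the length. The constant depends on the chain but not on the
    representation. *)
Lemma chain_bound a b L : spine_chain T phi p N a b L -> exists C : R,
  forall Z W, vertex_vectors Z W -> forall x y z r x' y' z' r',
    presents N a.1.1 a.2 x y z r -> presents N b.1.1 b.2 x' y' z' r' ->
    scale_u Z * frame_len (vertex_frame W (scale_u Z) a.1 x y z r)
      (vertex_frame W (scale_u Z) b.1 x' y' z' r') <= L + C * scaling_error Z.
Proof.
elim=> {a b L} [a sa|s q q' b L sq sq' chb [C IH]|a a' b L glue chb [C IH]].
- exists 11 => Z W vv x y z r x' y' z' r' pa pa'.
  have [ta ia] := sa.
  by have := tet_bound vv ta ia ia pa pa'; rewrite spine_len_xx.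
- exists (11 + C) => Z W vv x y z r x' y' z' r' pq pb.
  have [_ [tb ib]] := chain_points chb.
  have [ts iq] := sq; have [_ iq'] := sq'.
  have [x1 [y1 [z1 [r1 pq']]]] := presented ts iq'.
  have u0 := scale_u_gt0 Z.
  rewrite mulrDl addrACA.
  apply: (scaled_triangle u0 _ (tet_bound vv ts iq iq' pq pq')
    (IH Z W vv _ _ _ _ _ _ _ _ pq' pb)).
  exact: frame_len_triangle (vertex_frame_neq0 vv ts pq) (vertex_frame_neq0 vv ts pq')
     (vertex_frame_neq0 vv tb pb).
- have [f [w [r0 [sf wf r00 a2 a'2]]]] := glue.
  have [ta ta' a'1 _] := sf.
  have ia : in_spine N a.1.1 a.2 by rewrite a2; exact: tripod_pt_in_spine.
  exists (11 + C) => Z W vv x y z r x' y' z' r' pa pb.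
  have [[_ ia'] [tb ib]] := chain_points chb.
  have u0 := scale_u_gt0 Z.
  have [b1 /andP[b1w b1f]] := ord4_other w f.
  have [c1 /and3P[c1w c1b c1f]] : exists c, [&& c != w, c != b1 & c != f].
    have : (0 < #|~: [set w; b1; f]%SET|)%N.
      rewrite cardsCs finset.setCK card_ord subn_gt0 (@leq_ltn_trans 3) //.
      by rewrite -[X in (_ <= X)%N]/(2 + 1)%N (leq_trans (leq_card_setU _ _)) //
        cards1 leq_add2r cards2; case: eqP.
    by case/card_gt0P => c; rewrite !inE !negb_or -andbA; exists c.
  have uq : uniq [:: w; b1; c1; f].
    rewrite /= !inE !negb_or wf b1f c1f !andbT /= (eq_sym w b1) (eq_sym w c1) (eq_sym b1 c1).
    by rewrite b1w c1w c1b.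
  set sg := fp_perm T a.1.1 f in a'2.
  have uq' : uniq [:: sg w; sg b1; sg c1; sg f].
    by have := map_inj_uniq (@perm_inj _ sg) [:: w; b1; c1; f]; rewrite uq.
  have [X [k [X0 k0 qX pE _]]] := tropical_shape (trop a.1.1).
  have [X' [k' [X'0 k'0 qX' pE' _]]] := tropical_shape (trop a'.1.1).
  have ps : presents N a.1.1 a.2 w b1 c1 r0 by rewrite a2;
    exact: (tripod_presents X0 k0 qX pE uq r00).
  have pt : presents N a'.1.1 a'.2 (sg w) (sg b1) (sg c1) r0.
    by rewrite a'2; exact: (tripod_presents X'0 k'0 qX' pE' uq' r00).
  have [_ gl] := vv.
  have [kw kw0 ew] := gl _ _ _ w sf wf; have [kb kb0 eb] := gl _ _ _ b1 sf b1f.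
  have [kc kc0 ec] := gl _ _ _ c1 sf c1f.
  have same h : frame_len (vertex_frame W (scale_u Z) a'.1 (sg w) (sg b1) (sg c1) r0) h =
      frame_len (vertex_frame W (scale_u Z) a.1 w b1 c1 r0) h.
    rewrite ![frame_len _ h]frame_lenC {1}/vertex_frame ew eb ec tripod_frame_scale frame_len_scale //.
    by rewrite !mulf_neq0.
  have h1 := tet_bound vv ta ia ia pa ps; have h2 := IH Z W vv _ _ _ _ _ _ _ _ pt pb.
  rewrite spine_len_xx in h1; rewrite same in h2.
  rewrite -[L]add0r mulrDl addrACA; apply: (scaled_triangle u0 _ h1 h2).
  exact: frame_len_triangle (vertex_frame_neq0 vv ta pa) (vertex_frame_neq0 vv ta ps)
     (vertex_frame_neq0 vv tb pb).
Qed.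

Lemma chain_trans a b c L L' : spine_chain T phi p N a b L -> spine_chain T phi p N b c L' ->
  spine_chain T phi p N a c (L + L').
Proof.
move=> ab; elim: ab c L' =>
  {a b L} [a sa c L'|s q q' b L sq sq' _ IH c L' bc|a a' b L gl _ IH c L' bc].
- by rewrite add0r.
- by rewrite -addrA; apply: (chain_arc sq sq'); exact: IH.
- by apply: (chain_glue gl); exact: IH.
Qed.

Lemma seg0_in_spine j : in_spine N j (Seg 0).
Proof.
have [X [k [X0 k0 qX pE _]]] := tropical_shape (trop j).
by rewrite /= lexx qX X0.
Qed.

Lemma share_face_chain s t f : share_face T phi p s t f ->
  exists L, spine_chain T phi p N (s, Seg 0) (t, Seg 0) L.
Proof.
move=> sf; have [ts tt _ _] := sf.
have [w /andP[wf _]] := ord4_other f f.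
set q := tripod_pt N s.1 f w 0.
set q' := tripod_pt N t.1 (fp_perm T s.1 f f) (fp_perm T s.1 f w) 0.
have sq : is_spines_pt phi p N (s, q) by split => //; exact: tripod_pt_in_spine.
have sq' : is_spines_pt phi p N (t, q') by split => //; exact: tripod_pt_in_spine.
have s0 : is_spines_pt phi p N (s, Seg 0) by split => //; exact: seg0_in_spine.
have t0 : is_spines_pt phi p N (t, Seg 0) by split => //; exact: seg0_in_spine.
eexists; apply: (chain_arc s0 sq); apply: (chain_glue (a' := (t, q'))).
  by exists f, w, 0.
by apply: (chain_arc sq' t0); exact: chain_nil.
Qed.

End ChainBound.

(** * Vertex vectors of a representation, and limits *)

Section Representation.
Variables (R : realType) (n : nat) (T : face_pairing n).
Variables (M : topologicalType) (phi : 'I_n -> ideal_simplex R -> M).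
Variables (E : topologicalType) (p : E -> M) (e0 : E) (dk : set (R -> M) -> E -> E).
Local Notation vec := 'cV[R[i]]_2.

Lemma log_cabsV (x : R[i]) : x != 0 -> log_cabs x^-1 = - log_cabs x.
Proof. by move=> x0; rewrite /log_cabs cabsV lnV // posrE cabs_gt0. Qed.

Lemma log_cabs_cross_ratio (a b c d : vec) : cross_ratio a b c d != 0 ->
  [/\ cdet a c != 0, cdet a d != 0, cdet b d != 0 & cdet b c != 0] /\
  log_cabs (cross_ratio a b c d) =
    log_cabs (cdet a c) + log_cabs (cdet b d) - log_cabs (cdet a d) - log_cabs (cdet b c).
Proof.
rewrite /cross_ratio !cdetE !mulf_eq0 !invr_eq0 !negb_or.
move=> /andP[/andP[h1 h2] /andP[h3 h4]]; split => //.
by rewrite !log_cabsM ?mulf_neq0 ?invr_eq0 // !log_cabsV //; lra.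
Qed.

Lemma log_cabs_cdetC (a b : vec) : log_cabs (cdet a b) = log_cabs (cdet b a).
Proof. by rewrite cdetC /log_cabs cabsN. Qed.

(** The cross ratios are nonzero, which makes the vertex vectors of a tetrahedron pairwise
    independent. *)
Lemma vertex_vectors_exist (Z : 'M[R[i]]_(n, 3)) rho gamma :
  (forall j k, Z j k != 0) -> associated_representation T phi p e0 dk Z rho ->
  pi1 R M (p e0) gamma -> deck_transformation p (dk gamma) ->
  exists W, [/\ vertex_vectors T phi p Z W, \det (rho gamma) = 1 &
    forall s v, is_tet phi p s ->
      exists2 k, k != 0 & W (tet_act (dk gamma) s) v = k *: (rho gamma *m W s v)].
Proof.
move=> Z0 [[det1 _] [D [Dv [_ Dglue Dequiv _ Dinv]]]] hg dg.
have /choice[W WP] : forall s : tet R n E, exists w : 'I_4 -> vec, is_tet phi p s ->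
    [/\ forall v, w v != 0 /\ ideal_point (w v) = Dv s v,
        cross_ratio (w 0) (w 1) (w 2%:R) (w 3%:R) = Z s.1 0 &
        cross_ratio (w 0) (w 2%:R) (w 3%:R) (w 1) = Z s.1 1].
  move=> s; have [ts|nts] := pselect (is_tet phi p s); last by exists (fun=> 0).
  by have [w [h1 h2 h3 _]] := Dinv s ts; exists w.
exists W; split; [split| |].
- move=> s ts; have [_ z0 z1] := WP s ts.
  have [|[c02 c03 c13 c12] l0] := @log_cabs_cross_ratio (W s 0) (W s 1) (W s 2%:R) (W s 3%:R).
    by rewrite z0.
  have [|[_ c01 c21 c23] l1] := @log_cabs_cross_ratio (W s 0) (W s 2%:R) (W s 3%:R) (W s 1).
    by rewrite z1.
  rewrite /=; split.
  + have ind v w : cdet (W s v) (W s w) != 0 -> cdet (W s w) (W s v) != 0.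
      by rewrite cdetC oppr_eq0.
    move=> v w; case: (ord4P v) => ->; case: (ord4P w) => -> // _;
      first [assumption | by apply: ind].
  + by rewrite -z0 l0.
  + by rewrite -z1 l1 (log_cabs_cdetC (W s 2%:R) (W s 1)); lra.
- move=> s t f v sf vf; have [ts tt _ _] := sf.
  have [/(_ v)[w0 wE] _ _] := WP s ts.
  have [/(_ (fp_perm T s.1 f v))[w'0 w'E] _ _] := WP t tt.
  by apply: ideal_point_inj => //; rewrite wE w'E; apply/esym/(Dglue s t f v sf vf).
- exact: det1.
- move=> s v ts; have [_ equiv] := Dequiv gamma hg.
  have tt := tet_deck dg ts.
  have [/(_ v)[w0 wE] _ _] := WP s ts.
  have [/(_ v)[w'0 w'E] _ _] := WP _ tt.
  apply: ideal_point_inj => //; last by rewrite -psl_act_ideal_point // wE w'E equiv.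
  apply: contra w0 => /eqP Aw0.
  have u : rho gamma \in unitmx by rewrite unitmxE det1 // unitr1.
  by rewrite -(mulKmx u (W s v)) Aw0 mulmx0.
Qed.

End Representation.

Section Limits.
Variables (R : realType) (n : nat) (T : face_pairing n).
Variables (xi : 'M[R]_(n, 3)) (Z : nat -> 'M[R[i]]_(n, 3)).
Hypothesis hxi : \sum_j \sum_k xi j k ^+ 2 = 1.
Hypothesis hZ : forall i, deformation_variety T (Z i).
Hypothesis hcvg : scale_u (Z i) *: log_abs (Z i) @[i --> \oo] --> xi.

Local Notation err := (fun i => scaling_error xi (Z i)).

Lemma cvg_sum_ord (m : nat) (F : 'I_m -> nat -> R) (l : 'I_m -> R) :
  (forall k, F k i @[i --> \oo] --> l k) -> \sum_k F k i @[i --> \oo] --> \sum_k l k.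
Proof. by move=> Fl; apply: cvg_big => //; exact: add_continuous. Qed.

Lemma scaled_log_cvg j k : scale_u (Z i) * log_cabs (Z i j k) @[i --> \oo] --> xi j k.
Proof.
have -> : (fun i => scale_u (Z i) * log_cabs (Z i j k)) =
    (fun A : 'M[R]_(n, 3) => A j k) \o (fun i => scale_u (Z i) *: log_abs (Z i)).
  by apply/funext => i; rewrite /= !mxE.
by apply: (cvg_comp _ _ hcvg); exact: coord_continuous.
Qed.

Lemma scale_u_sqr (A : 'M[R[i]]_(n, 3)) :
  scale_u A ^+ 2 = 1 - \sum_j \sum_k (scale_u A * log_cabs (A j k)) ^+ 2.
Proof.
pose S := \sum_j \sum_k log_cabs (A j k) ^+ 2.
have S0 : 0 <= S by apply: sumr_ge0 => j _; apply: sumr_ge0 => k _; exact: sqr_ge0.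
have SE : \sum_j \sum_k log_abs A j k ^+ 2 = S.
  by apply: eq_bigr => j _; apply: eq_bigr => k _; rewrite mxE.
have -> : \sum_j \sum_k (scale_u A * log_cabs (A j k)) ^+ 2 = scale_u A ^+ 2 * S.
  rewrite /S mulr_sumr; apply: eq_bigr => j _; rewrite mulr_sumr.
  by apply: eq_bigr => k _; rewrite exprMn.
have -> : scale_u A ^+ 2 = (1 + S)^-1.
  by rewrite /scale_u SE exprVn sqr_sqrtr // addr_ge0.
by field; rewrite gt_eqF // ltr_pwDl.
Qed.

(** Together with [scale_u], the rescaled logarithms form a unit vector, and their limit
    [xi] is already a unit vector. *)
Lemma scale_u_cvg : scale_u (Z i) @[i --> \oo] --> (0 : R).
Proof.
have -> : (fun i => scale_u (Z i)) = Num.sqrt \o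
    (fun i => 1 - \sum_j \sum_k (scale_u (Z i) * log_cabs (Z i j k)) ^+ 2).
  apply/funext => i /=; rewrite -scale_u_sqr sqrtr_sqr ger0_norm // ltW //.
  exact: scale_u_gt0.
have : 1 - \sum_j \sum_k (scale_u (Z i) * log_cabs (Z i j k)) ^+ 2 @[i --> \oo] -->
    1 - \sum_j \sum_k xi j k ^+ 2.
  apply: (cvgB (cvg_cst _)).
  apply: cvg_sum_ord => j; apply: cvg_sum_ord => k.
  under eq_fun do rewrite expr2.
  by rewrite expr2; apply: cvgM; exact: scaled_log_cvg.
rewrite hxi subrr => h.
by have := cvg_comp _ _ h (@sqrt_continuous R 0); rewrite sqrtr0.
Qed.

Lemma scaling_error_cvg : err i @[i --> \oo] --> (0 : R).
Proof.
have e0 : \sum_(j < n) \sum_(k < 3) `|xi j k - xi j k| = 0.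
  by rewrite big1 // => j _; rewrite big1 // => k _; rewrite subrr normr0.
rewrite -[X in _ --> X](addr0 0) -[X in _ --> _ + X]e0.
apply: cvgD; first exact: scale_u_cvg.
apply: cvg_sum_ord => j; apply: cvg_sum_ord => k; apply: cvg_norm.
by apply: cvgB; [exact: scaled_log_cvg|exact: cvg_cst].
Qed.

Lemma le_from_error (x C : R) : (forall i, x <= C * err i) -> x <= 0.
Proof.
move=> le.
have h : C * err i @[i --> \oo] --> (0 : R).
  by rewrite -[X in _ --> X](mulr0 C); apply: cvgM; [exact: cvg_cst|exact: scaling_error_cvg].
rewrite -(cvg_lim (@Rhausdorff R) h).
by apply: limr_ge; [apply: cvgP h|exact: nearW].
Qed.

Lemma log_cabsD (x y : R[i]) : x != 0 -> y != 0 -> x + y != 0 ->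
  log_cabs (x + y) <= Num.max (log_cabs x) (log_cabs y) + 1.
Proof.
move=> x0 y0 xy0.
have px : 0 < cabs x by rewrite cabs_gt0.
have py : 0 < cabs y by rewrite cabs_gt0.
have ln2 : ln (2 : R) <= 1.
  by rewrite -[leRHS]expRK ler_ln ?posrE ?expR_gt0 ?ltr0n // (le_trans _ (expR_ge1Dx 1)).
have mE (a b : R) : 0 < a -> 0 < b -> a <= b -> ln (a + b) <= ln b + 1.
  move=> a0 b0 ab; apply: (@le_trans _ _ (ln (2 * b))).
    by rewrite ler_ln ?posrE ?addr_gt0 ?mulr_gt0 ?ltr0n // mulr_natl mulr2n lerD2r.
  by rewrite lnM ?posrE ?ltr0n // addrC lerD2l.
apply: (@le_trans _ _ (ln (cabs x + cabs y))).
  by rewrite ler_ln ?posrE ?addr_gt0 ?cabs_gt0 // cabsD.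
have [xy|/ltW yx] := leP (cabs x) (cabs y).
  by apply: le_trans (mE _ _ px py xy) _; rewrite lerD2r le_max lexx orbT.
by rewrite addrC; apply: le_trans (mE _ _ py px yx) _; rewrite lerD2r le_max lexx.
Qed.

Lemma scaled_max_le (u e A B C a b c : R) : 0 < u -> u <= e -> A <= Num.max B C + 1 ->
  `|u * A - a| <= e -> `|u * B - b| <= e -> `|u * C - c| <= e -> a - Num.max b c <= 3 * e.
Proof.
move=> u0 ue; rewrite -(ler_pM2l u0) mulrDr mulr1 maxr_pMr ?(ltW u0) // !ler_norml.
by case: (leP (u * B) (u * C)) => h1; case: (leP b c) => h2 h3 /andP[? ?] /andP[? ?] /andP[? ?];
  lra.
Qed.

(** With A and B the rescaled limits of log |z| and log |1 - z|, the triangle inequality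
    for z, 1 - z and 1 says that the maximum of 0, A and B is attained at least twice. *)
Lemma limit_tropical j : tropical xi j.
Proof.
have rel i : [/\ Z i j 0 != 0, Z i j 1 != 0, 1 - Z i j 0 != 0,
    log_cabs (Z i j 1) = - log_cabs (1 - Z i j 0) &
    log_cabs (Z i j 0) + log_cabs (Z i j 2%:R) = log_cabs (1 - Z i j 0)].
  have [Z0 /(_ j)[z02 z10 _] _] := hZ i.
  have n0 : 1 - Z i j 0 != 0.
    by apply/eqP => z0; move/eqP: z10; rewrite z0 mulr0 eq_sym oner_eq0.
  split => //.
    apply/eqP; rewrite -subr_eq0 opprK -log_cabsM // z10 /log_cabs.
    by rewrite (_ : cabs 1 = 1) ?ln1 // cabs1.
  rewrite -log_cabsM // (_ : Z i j 0 * Z i j 2%:R = - (1 - Z i j 0)); last first.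
    by rewrite -[1 in RHS]z02; ring.
  by rewrite /log_cabs cabsN.
have l1 : log_cabs (1 : R[i]) = 0 by rewrite /log_cabs cabs1 ln1.
have e1 (u e : R) : 0 < u -> u <= e -> `|u * log_cabs (1 : R[i]) - 0| <= e.
  by move=> u0 ue; rewrite l1 mulr0 subr0 normr0 (le_trans (ltW u0)).
have eE i k := scaling_error_coord xi (Z i) j k.
have uE i : 0 < scale_u (Z i) /\ scale_u (Z i) <= err i.
  by split; [exact: scale_u_gt0|have [] := scaling_error_ge xi (Z i)].
have eB i : `|scale_u (Z i) * log_cabs (1 - Z i j 0) - - xi j 1| <= err i.
  have [_ _ _ e _] := rel i; have := eE i 1.
  by rewrite e mulrN -normrN opprD !opprK.
have A_le : xi j 0 - Num.max 0 (- xi j 1) <= 0.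
  apply: (@le_from_error _ 3) => i; have [u0 ue] := uE i; have [z0 _ n0 _ _] := rel i.
  apply: (scaled_max_le u0 ue _ (eE i 0) (e1 _ _ u0 ue) (eB i)).
  have eN : log_cabs (- (1 - Z i j 0)) = log_cabs (1 - Z i j 0) by rewrite /log_cabs cabsN.
  have e : 1 + - (1 - Z i j 0) = Z i j 0 by ring.
  by rewrite -{1}e -eN; apply: log_cabsD; rewrite ?e ?oppr_eq0 ?oner_eq0.
have B_le : - xi j 1 - Num.max 0 (xi j 0) <= 0.
  apply: (@le_from_error _ 3) => i; have [u0 ue] := uE i; have [z0 _ n0 _ _] := rel i.
  apply: (scaled_max_le u0 ue _ (eB i) (e1 _ _ u0 ue) (eE i 0)).
  have eN : log_cabs (- Z i j 0) = log_cabs (Z i j 0) by rewrite /log_cabs cabsN.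
  by rewrite -eN; apply: log_cabsD; rewrite ?oppr_eq0 ?oner_eq0.
have one_le : 0 - Num.max (xi j 0) (- xi j 1) <= 0.
  apply: (@le_from_error _ 3) => i; have [u0 ue] := uE i; have [z0 _ n0 _ _] := rel i.
  apply: (scaled_max_le u0 ue _ (e1 _ _ u0 ue) (eE i 0) (eB i)).
  have e : Z i j 0 + (1 - Z i j 0) = 1 by ring.
  by rewrite -{1}e; apply: log_cabsD; rewrite ?e ?oner_eq0.
(* |z z' z''| = 1 *)
have sum0 s : s = 1 \/ s = -1 -> s * (xi j 0 + xi j 1 + xi j 2%:R) <= 0.
  move=> sE; apply: (@le_from_error _ 3) => i.
  have [_ _ _ r1 r2] := rel i.
  have r3 : scale_u (Z i) * log_cabs (Z i j 0) + scale_u (Z i) * log_cabs (Z i j 1) +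
      scale_u (Z i) * log_cabs (Z i j 2%:R) = 0.
    by rewrite -!mulrDr addrAC r2 r1 subrr mulr0.
  have := eE i 0; have := eE i 1; have := eE i 2%:R; rewrite !ler_norml.
  by move=> /andP[? ?] /andP[? ?] /andP[? ?]; case: sE => ->; lra.
have s0 : xi j 0 + xi j 1 + xi j 2%:R = 0.
  by have := sum0 1 (or_introl erefl); have := sum0 (-1) (or_intror erefl); lra.
move: A_le B_le one_le; rewrite /tropical.
case: (leP 0 (- xi j 1)) => h1; case: (leP 0 (xi j 0)) => h2; case: (leP (xi j 0) (- xi j 1)) =>
  h3 h4 h5 h6.
all: try by [apply: Or33; split; lra | apply: Or32; split; lra| apply: Or31; split; lra].
Qed.

End Limits.

(** * Translation lengths *)

Section Comparison.
Variables (R : realType) (n : nat) (T : face_pairing n).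
Variables (M : topologicalType) (phi : 'I_n -> ideal_simplex R -> M).
Variables (E : topologicalType) (p : E -> M) (e0 : E) (dk : set (R -> M) -> E -> E).
Variables (xi : 'M[R]_(n, 3)) (gamma : set (R -> M)).
Local Notation N := (quad_coords xi).
Local Notation chain := (spine_chain T phi p N).
Hypothesis trop : forall j, tropical xi j.
Hypothesis hg : pi1 R M (p e0) gamma.
Hypothesis dg : deck_transformation p (dk gamma).

Lemma translation_length_ge0 Z rho : associated_representation T phi p e0 dk Z rho ->
  0 <= translation_length (rho gamma).
Proof.
move=> [[det1 _] _].
pose g : 'cV[R[i]]_2 * 'cV[R[i]]_2 := (delta_mx 0 0, delta_mx 1 0).
have g0 : frame_det g != 0.
  by rewrite /frame_det /cdet /= !mxE /= mulr1 mulr0 subr0 oner_neq0.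
by have /andP[] := translation_length_bounds (det1 _ hg) g0.
Qed.

(** The chain from [a] to the translate of [b] is closed up by the chains joining [a] and
    [b] to [a0], which are arbitrarily short when [a] and [b] represent the same point
    of the tree as [a0]. *)
Lemma translation_length_chain a0 a b La L Lb :
  chain a0 a La -> chain a (tet_act (dk gamma) b.1, b.2) L -> chain a0 b Lb ->
  exists C : R, forall (Z : 'M[R[i]]_(n, 3)) rho, (forall j k, Z j k != 0) ->
    associated_representation T phi p e0 dk Z rho ->
    scale_u Z * translation_length (rho gamma) <= La + L + Lb + C * scaling_error xi Z.
Proof.
move=> ca cab cb.
have [C1 B1] := chain_bound trop ca; have [C2 B2] := chain_bound trop cab.
have [C3 B3] := chain_bound trop cb.
have [[t0 i0] [ta ia]] := chain_points trop ca.
have [_ [tb ib]] := chain_points trop cb.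
have [x0 [y0 [z0 [r0 p0]]]] := presented trop t0 i0.
have [x [y [z [r pa]]]] := presented trop ta ia.
have [x' [y' [z' [r' pb]]]] := presented trop tb ib.
exists (C1 + C2 + C3) => Z rho Z0 ar.
have [W [vv A1 eqv]] := vertex_vectors_exist Z0 ar hg dg.
have u0 := scale_u_gt0 Z.
set A := rho gamma in A1 eqv *.
have := B1 Z W vv _ _ _ _ _ _ _ _ p0 pa.
have := B2 Z W vv _ _ _ _ x' y' z' r' pa pb.
have := B3 Z W vv _ _ _ _ _ _ _ _ p0 pb.
have := vertex_frame_neq0 vv t0 p0; have := vertex_frame_neq0 vv ta pa.
have := vertex_frame_neq0 vv tb pb.
set g0 := vertex_frame _ _ a0.1 _ _ _ _; set g := vertex_frame _ _ a.1 _ _ _ _.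
set h := vertex_frame _ _ b.1 _ _ _ _; set h' := vertex_frame _ _ _ x' y' z' r'.
move=> h_n0 g_n0 g0_n0 bd3 bd2 bd1.
have [kx kx0 ex] := eqv b.1 x' tb; have [ky ky0 ey] := eqv b.1 y' tb.
have [kz kz0 ez] := eqv b.1 z' tb.
have h'E f : frame_len f h' = frame_len f (frame_act A h).
  rewrite /h' /vertex_frame ex ey ez tripod_frame_scale tripod_frame_act // frame_len_scale //.
  by rewrite !mulf_neq0.
have /andP[_ tl] := translation_length_bounds A1 g_n0.
have Ah_n0 : frame_det (frame_act A h) != 0 by rewrite frame_det_act.
have Ag_n0 : frame_det (frame_act A g) != 0 by rewrite frame_det_act.
have t1 := frame_len_triangle g_n0 Ah_n0 Ag_n0.
rewrite -h'E frame_len_act // in t1.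
have t2 := frame_len_triangle h_n0 g0_n0 g_n0.
rewrite [frame_len h g0]frame_lenC in t2.
have t3 := scaled_triangle u0 t2 bd3 bd1.
apply: le_trans (_ : scale_u Z * frame_len g (frame_act A g) <= _); first by rewrite ler_pM2l.
apply: le_trans (scaled_triangle u0 t1 bd2 t3) _.
by rewrite le_eqVlt; apply/orP; left; apply/eqP; ring.
Qed.

End Comparison.

Lemma increasing_seq_cvg (f : nat -> nat) : increasing_seq f -> f @ \oo --> \oo.
Proof.
move=> incf; have f_ge i : (i <= f i)%N.
  elim: i => // i; rewrite -ltnS => /leq_trans; apply.
  by move/increasing_seqP : incf; exact.
move=> P [m _ mP]; exists m => // i /= mi.
by apply: mP => /=; exact: leq_trans (f_ge i).
Qed.

Unset Implicit Arguments.

Theorem proposition6p6 (R : realType) (M : topologicalType)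
    (hM : interior_of_compact_3manifold_with_torus_boundary R M)
    (n : nat) (T : face_pairing n) (phi : 'I_n -> ideal_simplex R -> M)
    (hT : ideal_triangulation T phi)
    (E : topologicalType) (p : E -> M) (hp : universal_cover R E M p)
    (e0 : E) (dk : set (R -> M) -> E -> E) (hdk : pi1_deck_action p e0 dk)
    (xi : 'M[R]_(n, 3)) (hxi : D_infinity T xi)
    (Z : nat -> 'M[R[i]]_(n, 3)) (hZ : forall i, deformation_variety T (Z i))
    (hZxi : strongly_converges Z xi)
    (rho : nat -> set (R -> M) -> 'M[R[i]]_2)
    (hrho : forall i, associated_representation T phi p e0 dk (Z i) (rho i))
    (gamma : set (R -> M)) (hgamma : pi1 R M (p e0) gamma) :
  let a : nat -> R := fun i => scale_u (Z i) * translation_length (rho i gamma) in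
  (exists f : nat -> nat, increasing_seq f /\ cvgn (a \o f)) /\
  (forall (f : nat -> nat) (l : R), increasing_seq f -> a \o f @ \oo --> l ->
     0 <= l /\
     (l%:E <= tree_translation_length T phi p (quad_coords xi) (dk gamma))%E).
Proof.
move=> a.
have [hxi1 _] := hxi; have [Zcvg _] := hZxi.
have trop j : tropical xi j := limit_tropical hxi1 hZ Zcvg j.
have Z0 i j k : Z i j k != 0 by have [h _ _] := hZ i.
have [dg _] := hdk _ hgamma.
have err0 := scaling_error_cvg hxi1 Zcvg.
have a_ge0 i : 0 <= a i.
  apply: mulr_ge0; first by rewrite ltW // scale_u_gt0.
  by have := translation_length_ge0 hgamma (hrho i).
split.
- have [s0 [x0 [ts0 sx0]]] := tet_through e0 hT hp e0.
  pose N := quad_coords xi.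
  have [L chL] : exists L, spine_chain T phi p N (s0, Seg 0) (tet_act (dk gamma) s0, Seg 0) L.
    apply: (@tets_connected _ _ T _ phi _ p e0 hT hp
      (fun t => exists L, spine_chain T phi p N (s0, Seg 0) (t, Seg 0) L) s0 ts0).
    + by exists 0; apply: chain_nil; split => //; exact: seg0_in_spine.
    + move=> s t f [L chL] sf; have [L' chL'] := share_face_chain trop sf.
      by exists (L + L'); exact: chain_trans chL chL'.
    + exact: tet_deck.
  have ch0 : spine_chain T phi p N (s0, Seg 0) (s0, Seg 0) 0.
    by apply: chain_nil; split => //; exact: seg0_in_spine.
  have [C bd] := @translation_length_chain _ _ _ _ _ _ _ _ dk _ _ trop hgamma dg _ _ (s0, Seg 0) _ _ _ ch0 chL ch0.
  have bda i : a i <= L + C * scaling_error xi (Z i).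
    by have := bd _ _ (Z0 i) (hrho i); rewrite add0r addr0.
  have Cerr : C * scaling_error xi (Z i) @[i --> \oo] --> (0 : R).
    by rewrite -[X in _ --> X](mulr0 C); apply: cvgM; [exact: cvg_cst|exact: err0].
  have a_le : \forall i \near \oo, [set` `[0, L + 1]] (a i).
    have /cvgrPdist_lt /(_ 1 ltr01) := Cerr.
    apply: filterS => i; rewrite sub0r normrN ltr_norml => /andP[_ h].
    by rewrite /= in_itv /= a_ge0 (le_trans (bda i)) // lerD2l ltW.
  have [l [_ cl]] := @segment_compact R 0 (L + 1) (a @ \oo) _ a_le.
  have [f incf fl] := (cluster_eventually_cvg a l).1 cl.
  by exists f; split => //; apply/cvg_ex; exists l.
- move=> f l incf fl; split.
    rewrite -(cvg_lim (@Rhausdorff R) fl); apply: limr_ge; first by apply: cvgP fl.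
    by apply: nearW => i /=.
  apply/ereal_infP => _ [A [a0 sa0 AE] <-].
  apply/ereal_infP => _ [[a1 b1] /= [Aa1 [b Ab <-]] <-].
  apply/ereal_infP => _ [L chL <-].
  rewrite lee_fin; apply/ler_addgt0Pr => e e0'.
  move: Aa1 Ab; rewrite AE => -[sa1 d1] [sb db].
  have short c : spine_dist T phi p (quad_coords xi) a0 c = 0%E -> exists2 K : R,
      spine_chain T phi p (quad_coords xi) a0 c K & K < e / 2.
    move=> d0; have : (spine_dist T phi p (quad_coords xi) a0 c < (e / 2)%:E)%E.
      by rewrite d0 lte_fin divr_gt0 ?ltr0n.
    by move=> /ereal_inf_lt[_ [K chK <-]]; rewrite lte_fin; exists K.
  have [K1 ch1 K1e] := short _ d1; have [K2 ch2 K2e] := short _ db.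
  have [C bd] := translation_length_chain trop hgamma dg ch1 chL ch2.
  have errf : scaling_error xi (Z (f i)) @[i --> \oo] --> (0 : R).
    exact: (cvg_comp f (fun i => scaling_error xi (Z i)) (increasing_seq_cvg incf) err0).
  have ubcvg : K1 + L + K2 + C * scaling_error xi (Z (f i)) @[i --> \oo] --> K1 + L + K2.
    rewrite -[X in _ --> X]addr0; apply: cvgD; first exact: cvg_cst.
    rewrite -[X in _ --> X](mulr0 C); apply: cvgM; first exact: cvg_cst.
    exact: errf.
  have : l <= K1 + L + K2.
    apply: ler_cvg_to fl ubcvg _.
    by apply: nearW => i /=; exact: bd.
  lra.
Qed.
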